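(* (i) For $\mathcal{Q}\in\{\text{CQ},\text{rCQ}\}$, the following problem is undecidable: given a Horn-$\mathcal{ALC}$ TBox $\mathcal{T}_1$, an $\mathcal{ALC}$ TBox $\mathcal{T}_2$ and a pair of signatures $\Theta=(\Sigma_1,\Sigma_2)$, decide whether $\mathcal{T}_1$ $\Theta$-$\mathcal{Q}$ entails $\mathcal{T}_2$. (ii) For $\mathcal{Q}\in\{\text{CQ},\text{rCQ}\}$, the following problem is undecidable: given a Horn-$\mathcal{ALC}$ TBox $\mathcal{T}_1$, an $\mathcal{ALC}$ TBox $\mathcal{T}_2$ and $\Theta=(\Sigma_1,\Sigma_2)$, decide whether $\mathcal{T}_1$ and $\mathcal{T}_2$ are $\Theta$-$\mathcal{Q}$ inseparable. (iii) For $\mathcal{Q}=\text{CQ}$, the problems in (i) and (ii) remain undecidable when restricted to full ABox signatures ($\Sigma_1$ the set of all concept and role names), and also when restricted to pairs $\Theta=(\Sigma_1,\Sigma_2)$ with $\Sigma_1=\Sigma_2$.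
   Context: $\mathcal{ALC}$ concepts are built from concept names and $\top$ using $\neg$, $\sqcap$, $\exists R.C$; a TBox is a finite set of inclusions $C\sqsubseteq D$; a TBox is Horn-$\mathcal{ALC}$ if no $\neg C$ occurs negatively and no $\exists R.\neg C$ occurs positively. An ABox is a finite set of assertions $A(a)$, $R(a,b)$; a KB is $(\mathcal{T},\mathcal{A})$, $\mathsf{ind}$ denoting individuals; interpretations satisfy $a^{\mathcal{I}}=a$. A CQ $q(\vec x)=\exists\vec y\,\varphi$ is a conjunction of atoms $A(z)$, $R(z,z')$; it is rooted (rCQ) if every quantified variable is connected, in the undirected graph with edges $\{u,v\}$ for atoms $R(u,v)$, to some answer variable. $\mathcal{K}\models q(\vec a)$ means every model of $\mathcal{K}$ satisfies $q(\vec a)$. A $\Sigma$-query/ABox uses only names from $\Sigma$. For consistent KBs, $\mathcal{K}_1$ $\Sigma$-$\mathcal{Q}$ entails $\mathcal{K}_2$ if for every $\Sigma$-query $q(\vec x)$ in $\mathcal{Q}$ and tuple $\vec a$ from $\mathsf{ind}(\mathcal{K}_2)$, $\mathcal{K}_2\models q(\vec a)$ implies $\vec a\subseteq\mathsf{ind}(\mathcal{K}_1)$ and $\mathcal{K}_1\models q(\vec a)$. For TBoxes and $\Theta=(\Sigma_1,\Sigma_2)$, $\mathcal{T}_1$ $\Theta$-$\mathcal{Q}$ entails $\mathcal{T}_2$ if for every $\Sigma_1$-ABox $\mathcal{A}$ consistent with both $\mathcal{T}_1$ and $\mathcal{T}_2$, $(\mathcal{T}_1,\mathcal{A})$ $\Sigma_2$-$\mathcal{Q}$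 entails $(\mathcal{T}_2,\mathcal{A})$; $\mathcal{T}_1,\mathcal{T}_2$ are $\Theta$-$\mathcal{Q}$ inseparable if each $\Theta$-$\mathcal{Q}$ entails the other. *)

(* Defs.v *)
(* MathComp (boot only); lists of syntax objects that carry no eqType
   structure are handled with Stdlib's List.In. *)
From Stdlib Require List.
From Stdlib Require Import Relation_Operators.
From mathcomp Require Import all_boot.

Set Implicit Arguments.
Unset Strict Implicit.
Unset Printing Implicit Defensive.

(** * Syntax and semantics of ALC *)

Definition cname := nat.
Definition rname := nat.
Definition iname := nat.
Definition var := nat.

Inductive concept : Type :=
  | Name of cname
  | Top
  | Neg of concept
  | And of concept & concept
  | Ex of rname & concept.

(* (C, D) stands for the inclusion C ⊑ D. *)
Definition inclusion : Type := (concept * concept)%type.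
Definition tbox : Type := seq inclusion.

Inductive assertion : Type :=
  | CAssert of cname & iname
  | RAssert of rname & iname & iname.

Definition abox : Type := seq assertion.

Definition kb : Type := (tbox * abox)%type.

(* Individual names denote themselves: the domain of an interpretation is
   the set of individual names extended by an arbitrary type of anonymous
   elements. *)
Record interp : Type := Interp {
  anon : Type;
  cint : cname -> iname + anon -> Prop;
  rint : rname -> iname + anon -> iname + anon -> Prop
}.

Definition dom (I : interp) : Type := (iname + anon I)%type.

Fixpoint ceval (I : interp) (C : concept) (d : dom I) : Prop :=
  match C with
  | Name A => cint A d
  | Top => True
  | Neg D => ~ ceval D d
  | And D E => ceval D d /\ ceval E d
  | Ex R D => exists e : dom I, rint R d e /\ ceval D e
  end.

Definition tbox_sat (I : interp) (T : tbox) : Prop :=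
  forall ci, List.In ci T -> forall d : dom I, ceval ci.1 d -> ceval ci.2 d.

Definition assertion_sat (I : interp) (s : assertion) : Prop :=
  match s with
  | CAssert A a => @cint I A (inl a)
  | RAssert R a b => @rint I R (inl a) (inl b)
  end.

Definition abox_sat (I : interp) (A : abox) : Prop :=
  forall s, List.In s A -> assertion_sat I s.

Definition kb_model (K : kb) (I : interp) : Prop :=
  tbox_sat I K.1 /\ abox_sat I K.2.

Definition consistent (K : kb) : Prop := exists I, kb_model K I.

Definition assertion_inds (s : assertion) : seq iname :=
  match s with
  | CAssert _ a => [:: a]
  | RAssert _ a b => [:: a; b]
  end.

Definition ind (K : kb) : seq iname := flatten (map assertion_inds K.2).

(** * Horn TBoxes *)

(* occurs C true D: C occurs positively in D;
   occurs C false D: C occurs negatively in D. *)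
Inductive occurs (C : concept) : bool -> concept -> Prop :=
  | occurs_self : occurs C true C
  | occurs_andl p D E : occurs C p D -> occurs C p (And D E)
  | occurs_andr p D E : occurs C p E -> occurs C p (And D E)
  | occurs_ex p R D : occurs C p D -> occurs C p (Ex R D)
  | occurs_neg p D : occurs C p D -> occurs C (~~ p) (Neg D).

Definition tbox_occurs (C : concept) (p : bool) (T : tbox) : Prop :=
  exists2 ci, List.In ci T & occurs C (~~ p) ci.1 \/ occurs C p ci.2.

Definition horn (T : tbox) : Prop :=
  (forall C, ~ tbox_occurs (Neg C) false T) /\
  (forall R C, ~ tbox_occurs (Ex R (Neg C)) true T).

(** * Conjunctive queries *)

Inductive atom : Type :=
  | CAtom of cname & var
  | RAtom of rname & var & var.

Definition atom_vars (t : atom) : seq var :=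
  match t with
  | CAtom _ z => [:: z]
  | RAtom _ z z' => [:: z; z']
  end.

Record cq : Type := MkCQ {
  answer : seq var;
  quant : seq var;
  body : seq atom;
  cq_uniq : uniq (answer ++ quant);
  cq_closed : forall t, List.In t body ->
    {subset atom_vars t <= answer ++ quant}
}.

Definition atom_sat (I : interp) (h : var -> dom I) (t : atom) : Prop :=
  match t with
  | CAtom A z => cint A (h z)
  | RAtom R z z' => rint R (h z) (h z')
  end.

Definition cq_sat (I : interp) (q : cq) (a : seq iname) : Prop :=
  exists h : var -> dom I,
    map h (answer q) = map inl a /\
    forall t, List.In t (body q) -> atom_sat h t.

Definition kb_entails (K : kb) (q : cq) (a : seq iname) : Prop :=
  forall I, kb_model K I -> cq_sat I q a.

Definition cq_edge (q : cq) (u v : var) : Prop :=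
  exists R, List.In (RAtom R u v) (body q).

Definition rooted (q : cq) : Prop :=
  forall y, y \in quant q ->
    exists2 x, x \in answer q & clos_refl_sym_trans var (cq_edge q) x y.

Inductive qclass : Type := CQ | RCQ.

Definition in_class (Q : qclass) (q : cq) : Prop :=
  match Q with
  | CQ => True
  | RCQ => rooted q
  end.

(** * Signatures, query entailment and inseparability *)

(* inl: concept names; inr: role names. *)
Definition symbol : Type := (cname + rname)%type.
Definition signature : Type := symbol -> Prop.

Definition finsig : Type := seq symbol.
Definition sig_of (S : finsig) : signature := fun s => s \in S.
Definition full_sig : signature := fun _ => True.

Definition sig_abox (S : signature) (A : abox) : Prop :=
  forall s, List.In s A ->
    match s with
    | CAssert B _ => S (inl B)
    | RAssert R _ _ => S (inr R)
    end.

Definition sig_cq (S : signature) (q : cq) : Prop :=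
  forall t, List.In t (body q) ->
    match t with
    | CAtom B _ => S (inl B)
    | RAtom R _ _ => S (inr R)
    end.

Definition kb_query_entails (Q : qclass) (S : signature) (K1 K2 : kb) : Prop :=
  forall q, in_class Q q -> sig_cq S q ->
  forall a : seq iname, {subset a <= ind K2} ->
    kb_entails K2 q a ->
    {subset a <= ind K1} /\ kb_entails K1 q a.

Definition tbox_query_entails (Q : qclass) (S1 S2 : signature)
    (T1 T2 : tbox) : Prop :=
  forall A : abox, sig_abox S1 A ->
    consistent (T1, A) -> consistent (T2, A) ->
    kb_query_entails Q S2 (T1, A) (T2, A).

Definition tbox_inseparable (Q : qclass) (S1 S2 : signature)
    (T1 T2 : tbox) : Prop :=
  tbox_query_entails Q S1 S2 T1 T2 /\ tbox_query_entails Q S1 S2 T2 T1.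

(** * Turing machines and undecidability *)

Inductive move : Type := MoveL | Stay | MoveR.

(* Deterministic single-tape machines with two halting states, over an input
   alphabet X embedded into the tape alphabet. *)
Record TM (X : Type) : Type := MkTM {
  state : finType;
  tape_sym : finType;
  inp : X -> tape_sym;
  blank : tape_sym;
  start : state;
  acc : state;
  rej : state;
  delta : state -> tape_sym -> state * tape_sym * move;
  inp_inj : injective inp;
  inp_blank : forall x, inp x != blank;
  acc_rej : acc != rej
}.

(* The tape is infinite in both directions: tleft lists the cells to the left
   of the head, nearest first; tright starts with the scanned cell; all other
   cells are blank. *)
Record config (X : Type) (M : TM X) : Type := Config {
  cstate : state M;
  tleft : seq (tape_sym M);
  tright : seq (tape_sym M)
}.

Definition step (X : Type) (M : TM X) (c : config M) : config M :=
  if (cstate c == acc M) || (cstate c == rej M) then c else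
  let l := tleft c in
  let r := behead (tright c) in
  let: (q, s, m) := delta (cstate c) (head (blank M) (tright c)) in
  match m with
  | MoveL => Config q (behead l) (head (blank M) l :: s :: r)
  | Stay => Config q l (s :: r)
  | MoveR => Config q (s :: l) r
  end.

Definition init (X : Type) (M : TM X) (w : seq X) : config M :=
  Config (start M) [::] (map (@inp X M) w).

Definition accepts (X : Type) (M : TM X) (w : seq X) : Prop :=
  exists n, cstate (iter n (@step X M) (init M w)) = acc M.

Definition rejects (X : Type) (M : TM X) (w : seq X) : Prop :=
  exists n, cstate (iter n (@step X M) (init M w)) = rej M.

(* The problem "given an instance x satisfying valid, decide whether yes x"
   is undecidable: no machine halts with the correct answer on the encodings
   of all valid instances. Nothing is asked of it on other inputs. *)
Definition undecidable (X Inst : Type) (enc : Inst -> seq X)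
    (valid yes : Inst -> Prop) : Prop :=
  ~ exists M : TM X, forall x, valid x ->
      (yes x -> accepts M (enc x)) /\ (~ yes x -> rejects M (enc x)).

(** * Encoding of problem instances as words *)

(* Natural numbers in unary, concepts in prefix notation, lists with an
   explicit terminator. *)
Inductive token : Type :=
  TTick | TStop | TName | TTop | TNeg | TAnd | TEx | TCons | TNil.

Definition enc_nat (n : nat) : seq token := ncons n TTick [:: TStop].

Fixpoint enc_concept (C : concept) : seq token :=
  match C with
  | Name A => TName :: enc_nat A
  | Top => [:: TTop]
  | Neg D => TNeg :: enc_concept D
  | And D E => TAnd :: enc_concept D ++ enc_concept E
  | Ex R D => TEx :: enc_nat R ++ enc_concept D
  end.

Definition enc_inclusion (ci : inclusion) : seq token :=
  enc_concept ci.1 ++ enc_concept ci.2.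

Definition enc_symbol (s : symbol) : seq token :=
  match s with
  | inl A => TName :: enc_nat A
  | inr R => TEx :: enc_nat R
  end.

Fixpoint enc_seq (U : Type) (enc : U -> seq token) (l : seq U) : seq token :=
  match l with
  | [::] => [:: TNil]
  | x :: l' => TCons :: enc x ++ enc_seq enc l'
  end.

Definition enc_tbox : tbox -> seq token := enc_seq enc_inclusion.
Definition enc_sig : finsig -> seq token := enc_seq enc_symbol.

Record instance : Type := Instance {
  tb1 : tbox;
  tb2 : tbox;
  sig1 : finsig;
  sig2 : finsig
}.

Definition enc_instance (i : instance) : seq token :=
  enc_tbox (tb1 i) ++ enc_tbox (tb2 i) ++ enc_sig (sig1 i) ++ enc_sig (sig2 i).

(* Instances whose ABox signature is the (infinite) full one, so that only
   the query signature is part of the input. *)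
Record full_instance : Type := FullInstance {
  ftb1 : tbox;
  ftb2 : tbox;
  fsig2 : finsig
}.

Definition enc_full_instance (i : full_instance) : seq token :=
  enc_tbox (ftb1 i) ++ enc_tbox (ftb2 i) ++ enc_sig (fsig2 i).

Definition prefix_code (U : Type) (enc : U -> seq token) : Prop :=
  forall x y u v, enc x ++ u = enc y ++ v -> x = y /\ u = v.

Lemma enc_nat_prefix : prefix_code enc_nat.
Proof.
elim=> [|m IH] [|n] u v //=; first by case.
by case=> /IH [-> ->].
Qed.

Lemma enc_concept_prefix : prefix_code enc_concept.
Proof.
elim=> [A||C IH|C IHC D IHD|R C IH] [B||C'|C' D'|R' C'] u v //=; case.
- by move=> /enc_nat_prefix [-> ->].
- by [].
- by move=> /IH [-> ->].
- by rewrite -!catA => /IHC [-> /IHD [-> ->]].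
- by rewrite -!catA => /enc_nat_prefix [-> /IH [-> ->]].
Qed.

Lemma enc_inclusion_prefix : prefix_code enc_inclusion.
Proof.
move=> [C D] [C' D'] u v; rewrite /enc_inclusion /= -!catA.
by move=> /enc_concept_prefix [-> /enc_concept_prefix [-> ->]].
Qed.

Lemma enc_symbol_prefix : prefix_code enc_symbol.
Proof.
by case=> m [] n u v //= [] /enc_nat_prefix [-> ->].
Qed.

Lemma enc_seq_prefix (U : Type) (enc : U -> seq token) :
  prefix_code enc -> prefix_code (enc_seq enc).
Proof.
move=> encP; elim=> [|x l IH] [|y k] u v //=; first by case.
by case; rewrite -!catA => /encP [-> /IH [-> ->]].
Qed.

Lemma enc_instance_inj : injective enc_instance.
Proof.
have tP := enc_seq_prefix enc_inclusion_prefix.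
have sP := enc_seq_prefix enc_symbol_prefix.
move=> [T1 T2 S1 S2] [T1' T2' S1' S2'].
rewrite /enc_instance /= -[enc_sig S2]cats0 -[enc_sig S2']cats0.
by move=> /tP [-> /tP [-> /sP [-> /sP [-> _]]]].
Qed.

Lemma enc_full_instance_inj : injective enc_full_instance.
Proof.
have tP := enc_seq_prefix enc_inclusion_prefix.
have sP := enc_seq_prefix enc_symbol_prefix.
move=> [T1 T2 S2] [T1' T2' S2'].
rewrite /enc_full_instance /= -[enc_sig S2]cats0 -[enc_sig S2']cats0.
by move=> /tP [-> /tP [-> /sP [-> _]]].
Qed.

(** * The decision problems *)

Definition horn_instance (i : instance) : Prop := horn (tb1 i).

Definition horn_full_instance (i : full_instance) : Prop := horn (ftb1 i).

Definition equal_sigs (i : instance) : Prop := sig1 i =i sig2 i.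

Definition entailment (Q : qclass) (i : instance) : Prop :=
  tbox_query_entails Q (sig_of (sig1 i)) (sig_of (sig2 i)) (tb1 i) (tb2 i).

Definition inseparability (Q : qclass) (i : instance) : Prop :=
  tbox_inseparable Q (sig_of (sig1 i)) (sig_of (sig2 i)) (tb1 i) (tb2 i).

Definition full_entailment (Q : qclass) (i : full_instance) : Prop :=
  tbox_query_entails Q full_sig (sig_of (fsig2 i)) (ftb1 i) (ftb2 i).

Definition full_inseparability (Q : qclass) (i : full_instance) : Prop :=
  tbox_inseparable Q full_sig (sig_of (fsig2 i)) (ftb1 i) (ftb2 i).

(* Main.v *)
(** Given a machine M, an instance is constructed that is a yes-instance iff M
    does not accept its encoding; hence M is not a decider.

    The ALC TBox hangs from every A-element a tree whose branches spell
    alternately the letters of a sequence of rows and the letters of the same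
    sequence delayed by one row, a finite automaton checking that each row is the
    configuration of M that succeeds its delayed companion. Where a branch reaches
    acceptance, a disjunction decides whether it ends with an E-element or goes on
    with arbitrary letters. A path query that starts at an I-element and ends at an
    E-element is entailed iff one branch matches it in both cases: in the first
    case from the root of the tree, where it reads the rows, in the second one from
    the end of the initial row, where, this being an odd number of steps later, it
    reads the delayed rows. Both being the same word, the word is an accepting run.
    The canonical tree of the Horn TBox matches every connected query in which no
    such path is forced, and no other.

    The initial row has to be the encoding of the instance itself. It is spelled by
    a nested existential restriction in the ALC TBox, one symbol per restriction,
    and the cell of a symbol carries, besides the symbol, the block of tokens that
    encodes its restriction; M reads first the symbols that precede the nested
    concept in the encoding, then all blocks, then the symbols that follow it. The
    jumps of the head between these tracks are no obstacle, since consecutive rows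
    are compared by an automaton that scans the whole row. *)
From Stdlib Require List.
From Stdlib Require Import Relation_Operators.
From HB Require Import structures.
From mathcomp Require Import all_boot boolp zify.
Require Import Defs.

Set Implicit Arguments.
Unset Strict Implicit.
Unset Printing Implicit Defensive.

(** The self-reference is not circular: the nested restriction spells only the parts of the encoding
    that surround it, and the symbols of these parts determine the blocks of which its own encoding
    consists. ABoxes could assert the names that drive the trees. All axioms on nodes are therefore
    guarded by a gate name, one for each TBox, and each TBox declares the gate of the other one
    empty: an ABox consistent with both asserts no gate, and only its [A_name] assertions trigger
    axioms. ABox elements named [I_name] are a second danger, as a query could then be matched
    partly outside of a tree and enter it. Either the trees hang from [P_role], which queries cannot
    use, and a connected query stays on one side; or the ABox signature has no concept name but
    [A_name]. Rooted queries have to enter the tree from an individual and call for the second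
    remedy; full and equal signatures leave only the first one, hence CQs. For inseparability, the
    ALC TBox repeats the root and node axioms of the Horn TBox under its own gate, so that it always
    entails the Horn TBox. *)

Lemma InP (T : eqType) (x : T) (s : seq T) : reflect (List.In x s) (x \in s).
Proof.
elim: s => [|y s IH] /=; first by constructor.
rewrite inE; apply: (iffP orP) => -[].
- by move=> /eqP ->; left.
- by move=> /IH; right.
- by move=> ->; left.
- by move=> /IH; right.
Qed.

Lemma In_cat (T : Type) (x : T) (s1 s2 : seq T) :
  List.In x (s1 ++ s2) <-> List.In x s1 \/ List.In x s2.
Proof. by elim: s1 => [|y s IH] /=; [tauto | rewrite IH; tauto]. Qed.

Lemma In_map (T U : Type) (f : T -> U) (y : U) (s : seq T) :
  List.In y (map f s) <-> exists2 x, List.In x s & y = f x.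
Proof.
elim: s => [|z s IH] /=; first by split=> // -[].
rewrite IH; split=> [[<-|[x xs ->]]|[x [->|xs] ->]]; last by right; exists x.
- by exists z => //; left.
- by exists x => //; right.
- by left.
Qed.

(** * Turing machines *)

Section Machines.
Variables (X : Type) (M : TM X).

Definition halting (q : state M) : bool := (q == acc M) || (q == rej M).

Lemma iter_halting n (c : config M) :
  halting (cstate c) -> iter n (@step X M) c = c.
Proof.
by move=> h; elim: n => //= n ->; move: h; rewrite /step /halting => ->.
Qed.

Lemma accepts_rejects (w : seq X) : accepts M w -> rejects M w -> False.
Proof.
move=> [n hn] [m hm].
have := acc_rej M; rewrite -hn -hm => /eqP; case: (leqP n m) => nm; apply.
  by rewrite -(subnK nm) iterD [in RHS]iter_halting // /halting hn eqxx.
by rewrite -(subnK (ltnW nm)) iterD iter_halting // /halting hm eqxx orbT.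
Qed.

Lemma accepts_nonhalting (w : seq X) : accepts M w ->
  exists2 n, cstate (iter n (@step X M) (init M w)) = acc M &
    forall m, m < n -> ~~ halting (cstate (iter m (@step X M) (init M w))).
Proof.
move=> aw; have [n0 hn0] := aw.
have ex : exists n, cstate (iter n (@step X M) (init M w)) == acc M.
  by exists n0; apply/eqP.
case: (ex_minnP ex) => n /eqP hn nmin; exists n => // m mn.
apply/negP => /orP[/nmin|/eqP rm]; first by rewrite leqNgt mn.
by apply: accepts_rejects aw _; exists m.
Qed.

End Machines.

(** * The words spelled out by chains of existential restrictions *)

Definition token_code (t : token) : nat :=
  match t with
  | TTick => 0 | TStop => 1 | TName => 2 | TTop => 3 | TNeg => 4
  | TAnd => 5 | TEx => 6 | TCons => 7 | TNil => 8
  end.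

Definition token_decode (n : nat) : token :=
  nth TNil [:: TTick; TStop; TName; TTop; TNeg; TAnd; TEx; TCons; TNil] n.

Lemma token_code_lt t : token_code t < 9.
Proof. by case: t. Qed.

Lemma token_code_ordK :
  cancel (fun t => Ordinal (token_code_lt t)) (fun i : 'I_9 => token_decode i).
Proof. by case. Qed.

HB.instance Definition _ := Finite.copy token (can_type token_code_ordK).

(* A symbol of the spelled word, with a flag telling whether it belongs to the
   part of the instance's encoding that precedes (false) or follows (true) the
   encoding of the chain itself. *)
Definition datum : Type := (token * bool)%type.

Definition A_name : cname := 0.
Definition I_name : cname := 1.
Definition E_name : cname := 2.
Definition gate1 : cname := 3.
Definition gate2 : cname := 4.
(** Fixed numerals rather than ranks in an enumeration of nodes: blocks contain these names, the
    sizes of blocks bound the tracks, and the tracks determine the finite types of letters and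
    nodes. *)
Definition datum_name (x : datum) : cname := 5 + (token_code x.1).*2 + x.2.
Definition R_role : rname := 0.
Definition P_role : rname := 1.

Lemma datum_name_bounds x : 5 <= datum_name x < 23.
Proof. by case: x => [[] []]. Qed.

Lemma datum_name_inj : injective datum_name.
Proof. by move=> [[] []] [[] []]. Qed.

Fixpoint chain (C : concept) (us : seq datum) : concept :=
  if us is x :: us' then
    Ex R_role (And (Name gate2)
      (And (Name (datum_name x)) (Ex R_role (chain C us'))))
  else C.

Definition block (x : datum) : seq token :=
  TEx :: enc_nat R_role ++ TAnd :: enc_concept (Name gate2) ++
  TAnd :: enc_concept (Name (datum_name x)) ++ TEx :: enc_nat R_role.

Lemma enc_chain C us :
  enc_concept (chain C us) = flatten (map block us) ++ enc_concept C.
Proof.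
elim: us => //= x us ->.
by rewrite /block /= -?catA /= -?catA.
Qed.

Definition spelled (pre post : seq token) : seq datum :=
  [seq (t, false) | t <- pre] ++ [seq (t, true) | t <- post].

(** The successor makes the bound positive by computation, as a track of one slot requires. *)
Definition track_bound : nat := (\max_(x : datum) size (block x)).+1.

Lemma size_block x : size (block x) <= track_bound.
Proof. by rewrite leqW // (bigD1 x) //= leq_maxl. Qed.

(** * Slots and head moves *)

Section Rows.
Variable M : TM token.

Notation sym := (tape_sym M).

(* [None] is an extra initial state, in which the head is on the cell to the
   left of the input. *)
Definition ostate : Type := option (state M).

Definition slot : Type := (sym * bool)%type.

Definition odelta (q : ostate) (a : sym) : ostate * sym * move :=
  if q is Some q1 then
    let: (q', b, m) := delta q1 a in (Some q', b, m)
  else (Some (start M), a, MoveR).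

Definition ohalting (q : ostate) : bool :=
  if q is Some q1 then halting q1 else false.

(* The head flags [n] are the flags [o] shifted by one slot in the direction
   [m]; [x] and [y] are the flags that cross the left and right ends. *)
Definition heads_ok (m : move) (x : bool) (o n : seq bool) (y : bool) : bool :=
  match m with
  | MoveR => x :: o == rcons n y
  | MoveL => x :: n == rcons o y
  | Stay => (o == n) && (x == y)
  end.

Definition slots_ok (a b : sym) (m : move) (x : bool) (o n : seq slot)
    (y : bool) : bool :=
  [&& size o == size n, all (fun s => s.2 ==> (s.1 == a)) o,
      unzip1 n == [seq if s.2 then b else s.1 | s <- o] &
      heads_ok m x (unzip2 o) (unzip2 n) y].

Lemma heads_ok_nil m x y : heads_ok m x [::] [::] y = (x == y).
Proof. by case: m => //=; rewrite eqseq_cons eqxx andbT. Qed.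

(** Two adjacent words interact only through the flag that crosses the border between them. This
    locality lets a finite automaton check a head move letter by letter. *)
Lemma heads_ok_cat m x o1 o2 n1 n2 y : size o1 = size n1 ->
  heads_ok m x (o1 ++ o2) (n1 ++ n2) y =
  [exists z, heads_ok m x o1 n1 z && heads_ok m z o2 n2 y].
Proof.
elim: o1 n1 x => [|o o1 IH] [|n n1] x //= => [_|[/IH{}IH]].
  apply/idP/existsP => [h|[z /andP[]]]; first by exists x; rewrite heads_ok_nil eqxx.
  by rewrite heads_ok_nil => /eqP ->.
have pullb (c : bool) (F G : bool -> bool) :
    [exists z, c && F z && G z] = c && [exists z, F z && G z].
  by case: c => //=; apply/existsP => -[].
case: m IH => IH; rewrite /heads_ok /= !eqseq_cons.
- have /= -> := IH n; rewrite -pullb.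
  exact: eq_existsb.
- have := IH x; rewrite /heads_ok /= -andbA => ->; rewrite -pullb.
  by apply: eq_existsb => z; rewrite -!andbA.
- have /= -> := IH o; rewrite -pullb.
  exact: eq_existsb.
Qed.

Lemma slots_ok_nil a b m x y : slots_ok a b m x [::] [::] y = (x == y).
Proof. by rewrite /slots_ok heads_ok_nil. Qed.

Lemma slots_ok_size a b m x o n y : slots_ok a b m x o n y -> size n = size o.
Proof. by case/and4P => /eqP. Qed.

Lemma slots_ok_cat a b m x o1 o2 n1 n2 y : size o1 = size n1 ->
  slots_ok a b m x (o1 ++ o2) (n1 ++ n2) y =
  [exists z, slots_ok a b m x o1 n1 z && slots_ok a b m z o2 n2 y].
Proof.
move=> eq_sz; rewrite /slots_ok !size_cat eq_sz eqn_add2l eqxx /= all_cat.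
rewrite /unzip1 /unzip2 !map_cat eqseq_cat ?size_map //.
rewrite heads_ok_cat ?size_map //.
case: (size o2 == size n2) => /=; last first.
  by apply/esym/existsP => -[z]; rewrite andbF.
case: (all _ o1); case: (all _ o2); case: (_ == _); case: (_ == _) => //=;
  by apply/esym/existsP => -[z]; rewrite ?andbF.
Qed.

Lemma slots_ok_split a b m x o1 o2 n y : slots_ok a b m x (o1 ++ o2) n y ->
  exists n1 n2 z, [/\ n = n1 ++ n2, slots_ok a b m x o1 n1 z &
    slots_ok a b m z o2 n2 y].
Proof.
move=> ok; have := slots_ok_size ok; rewrite size_cat => sz.
have s1 : size o1 = size (take (size o1) n).
  by rewrite size_takel // sz leq_addr.
move: ok; rewrite -{1}(cat_take_drop (size o1) n) slots_ok_cat //.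
case/existsP => z /andP[h1 h2]; exists (take (size o1) n), (drop (size o1) n), z.
by rewrite cat_take_drop.
Qed.

(** * Tapes *)

Definition tape (L : seq sym) (a : sym) (R : seq sym) : seq slot :=
  [seq (s, false) | s <- rev L] ++ (a, true) :: [seq (s, false) | s <- R].

Definition moved (m : move) (b : sym) (L R : seq sym) (L' : seq sym) (a' : sym)
    (R' : seq sym) : Prop :=
  match m with
  | MoveR => R = a' :: R' /\ L' = b :: L
  | MoveL => L = a' :: L' /\ R' = b :: R
  | Stay => [/\ L' = L, R' = R & a' = b]
  end.

Lemma unzip1_tape L a R : unzip1 (tape L a R) = rev L ++ a :: R.
Proof. by rewrite /unzip1 map_cat /= -!map_comp !map_id. Qed.

Lemma unzip2_tape L a R :
  unzip2 (tape L a R) = nseq (size L) false ++ true :: nseq (size R) false.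
Proof.
have mapF (s : seq sym) : [seq (x, false).2 | x <- s] = nseq (size s) false.
  by elim: s => //= _ s ->.
by rewrite /unzip2 map_cat /= -!map_comp /comp !mapF size_rev.
Qed.

Lemma eq_unzip (s t : seq slot) : unzip1 s = unzip1 t -> unzip2 s = unzip2 t -> s = t.
Proof. by move=> h1 h2; rewrite -(zip_unzip s) -(zip_unzip t) h1 h2. Qed.

Lemma write_tape a b L R :
  [seq if s.2 then b else s.1 | s <- tape L a R] = rev L ++ b :: R.
Proof. by rewrite map_cat /= -!map_comp !map_id. Qed.

Lemma rcons_nseq (T : Type) (x : T) n : rcons (nseq n x) x = nseq n.+1 x.
Proof. by elim: n => //= n ->. Qed.

Lemma slots_ok_tape a b m L R L' a' R' : moved m b L R L' a' R' ->
  slots_ok a b m false (tape L a R) (tape L' a' R') false.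
Proof.
move=> mv; rewrite /slots_ok write_tape unzip1_tape !unzip2_tape.
have -> : all (fun s => s.2 ==> (s.1 == a)) (tape L a R).
  have allF r : all (fun s : slot => s.2 ==> (s.1 == a)) [seq (s, false) | s <- r].
    by elim: r.
  by rewrite all_cat /= eqxx !allF.
rewrite /tape !size_cat /= !size_map !size_rev.
case: m mv => /=.
- move=> [-> ->]; rewrite /= rev_cons cat_rcons eqxx !addSn !addnS eqxx.
  by rewrite rcons_cat /= rcons_nseq eqxx.
- by move=> [-> -> ->]; rewrite !eqxx.
- move=> [-> ->]; rewrite /= rev_cons cat_rcons eqxx !addSn !addnS eqxx.
  by rewrite rcons_cat /= rcons_nseq /= eqxx.
Qed.

(** False flags at both ends keep the head from leaving or entering the tape, so whatever passes the
    comparison is again a tape with a single head, one step later. *)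
Lemma slots_ok_tapeP a0 b m L a R V :
  slots_ok a0 b m false (tape L a R) V false ->
  a0 = a /\ exists L' a' R', V = tape L' a' R' /\ moved m b L R L' a' R'.
Proof.
case/and4P=> _; rewrite all_cat /= => /and3P[_ /eqP -> _].
rewrite write_tape unzip2_tape => /eqP V1 V2; split=> //.
case: m V2 => /=.
- case: L V1 => [|a' L] V1; rewrite //= => /eqP[V2].
  exists L, a', (b :: R); split=> //; apply: eq_unzip.
    by rewrite V1 unzip1_tape rev_cons cat_rcons.
  by rewrite V2 unzip2_tape rcons_cat /= rcons_nseq.
- rewrite andbT => /eqP V2; exists L, b, R; split=> //.
  by apply: eq_unzip; rewrite ?unzip1_tape ?unzip2_tape.
- case: R V1 => [|a' R] V1.
    by rewrite cats1 -rcons_cons eqseq_rcons andbF.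
  rewrite -rcons_nseq -!rcons_cons -rcons_cat -rcons_cons eqseq_rcons eqxx andbT => /eqP V2.
  exists (b :: L), a', R; split=> //; apply: eq_unzip.
    by rewrite V1 unzip1_tape rev_cons cat_rcons.
  by rewrite -V2 unzip2_tape.
Qed.

End Rows.

(** * Letters with three tracks and the automaton comparing consecutive rows *)

Section Letters.
Variable M : TM token.

Notation sym := (tape_sym M).
Notation slot := (slot M).
Notation ostate := (ostate M).

Definition track : Type := track_bound.-bseq slot.

Definition glob : Type := (ostate * sym)%type.

Definition letter : Type := (glob * bool * (track * track * track))%type.

Definition letter_glob (l : letter) : glob := l.1.1.
Definition letter_last (l : letter) : bool := l.1.2.
Definition trackA (l : letter) : seq slot := l.2.1.1.
Definition trackB (l : letter) : seq slot := l.2.1.2.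
Definition trackC (l : letter) : seq slot := l.2.2.

Definition spell (tr : letter -> seq slot) (r : seq letter) : seq slot :=
  flatten [seq tr l | l <- r].

(* One symbol of the spelled word stands on the tape both for itself, in the first
   or in the third part, and for its block, in the second part. *)
Definition row_tape (r : seq letter) : seq slot :=
  spell trackA r ++ spell trackB r ++ spell trackC r.

(* A state of the automaton comparing consecutive rows holds the global data of
   the two rows, the flag to be carried into the next slot of each track, and
   the guessed flags carried into the second and third tracks. *)
Definition astate : Type :=
  (glob * glob * (bool * bool * bool) * (bool * bool))%type.

Definition oglob (z : astate) : glob := z.1.1.1.
Definition nglob (z : astate) : glob := z.1.1.2.
Definition carryA (z : astate) : bool := z.1.2.1.1.
Definition carryB (z : astate) : bool := z.1.2.1.2.
Definition carryC (z : astate) : bool := z.1.2.2.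
Definition enterB (z : astate) : bool := z.2.1.
Definition enterC (z : astate) : bool := z.2.2.

(** The tracks are scanned in parallel although the tape is their concatenation. A flag guessed on
    entering the second or third track is checked only at the end of the row, by [afinal], against
    the flag that leaves the preceding track. *)
Definition ainit (z : astate) : bool :=
  [&& ~~ carryA z, carryB z == enterB z & carryC z == enterC z].

Definition afinal (z : astate) : bool :=
  [&& carryA z == enterB z, carryB z == enterC z & ~~ carryC z].

Definition astep (z : astate) (s t : letter) (z1 : astate) : bool :=
  let: (q, b, m) := odelta (oglob z).1 (oglob z).2 in
  let ok := slots_ok (oglob z).2 b m in
  [&& z1.1.1 == z.1.1, z1.2 == z.2, letter_glob s == oglob z,
      letter_glob t == nglob z, letter_last t == letter_last s,
      ~~ ohalting (oglob z).1, q == (nglob z).1 &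
      [&& ok (carryA z) (trackA s) (trackA t) (carryA z1),
          ok (carryB z) (trackB s) (trackB t) (carryB z1) &
          ok (carryC z) (trackC s) (trackC t) (carryC z1)]].

Fixpoint asteps (z : astate) (r r' : seq letter) (z1 : astate) : Prop :=
  match r, r' with
  | [::], [::] => z = z1
  | s :: r, t :: r' => exists2 z2, astep z s t z2 & asteps z2 r r' z1
  | _, _ => False
  end.

Definition row_step (r r' : seq letter) : Prop :=
  exists z z1, [/\ ainit z, asteps z r r' z1 & afinal z1].

Lemma asteps_size z r r' z1 : asteps z r r' z1 -> size r' = size r.
Proof. by elim: r r' z => [|s r IH] [|t r'] z //= [z2 _ /IH ->]. Qed.

Lemma asteps_last z r r' z1 : asteps z r r' z1 ->
  [seq letter_last t | t <- r'] = [seq letter_last s | s <- r].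
Proof.
elim: r r' z => [|s r IH] [|t r'] z //= [z2 st /IH ->]; congr (_ :: _).
by move: st; rewrite /astep; case: odelta => -[q b] m /and5P[_ _ _ _ /andP[/eqP]].
Qed.

Lemma asteps_params z r r' z1 : asteps z r r' z1 -> z1.1.1 = z.1.1 /\ z1.2 = z.2.
Proof.
elim: r r' z => [|s r IH] [|t r'] z //=; first by move=> ->.
move=> [z2 st /IH [-> ->]].
by move: st; rewrite /astep; case: odelta => -[q b] m /and3P[/eqP -> /eqP ->].
Qed.

Lemma asteps_glob z r r' z1 : asteps z r r' z1 ->
  all (fun s => letter_glob s == oglob z) r /\
  all (fun t => letter_glob t == nglob z) r'.
Proof.
elim: r r' z => [|s r IH] [|t r'] z //= [z2 st].
move: st; rewrite /astep; case: odelta => -[q b] m.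
move=> /and5P[/eqP e _ /eqP -> /eqP -> _] /IH; rewrite /oglob /nglob e !eqxx.
by [].
Qed.

Lemma asteps_track (tr : letter -> seq slot) (carry : astate -> bool)
    q b m z r r' z1 :
  odelta (oglob z).1 (oglob z).2 = (q, b, m) ->
  (forall z s t z', oglob z = oglob z1 -> astep z s t z' ->
    slots_ok (oglob z).2 b m (carry z) (tr s) (tr t) (carry z')) ->
  asteps z r r' z1 ->
  slots_ok (oglob z).2 b m (carry z) (spell tr r) (spell tr r') (carry z1).
Proof.
move=> dz trP; elim: r r' z dz => [|s r IH] [|t r'] z //= dz.
  by move=> ->; rewrite slots_ok_nil.
move=> [z2 st h]; have [e2 _] := asteps_params h.
have e1 : oglob z = oglob z2.
  by move: st; rewrite /astep dz /oglob => /andP[/eqP ->].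
have h1 := trP _ _ _ _ _ st; rewrite /spell /= slots_ok_cat; last first.
  by apply/esym/slots_ok_size/h1; rewrite e1 /oglob e2.
apply/existsP; exists (carry z2); rewrite h1 ?e1 /oglob ?e2 //=.
by rewrite -/(oglob z2) IH // -e1.
Qed.

(** At least one letter must be there for the automaton to test the state and the transition, whence
    the nonempty row. *)
Lemma row_step_sound r r' : r != [::] -> row_step r r' ->
  exists g g' b m, [/\ all (fun s => letter_glob s == g) r,
    all (fun t => letter_glob t == g') r', ~~ ohalting g.1,
    odelta g.1 g.2 = (g'.1, b, m) &
    slots_ok g.2 b m false (row_tape r) (row_tape r') false].
Proof.
move=> r0 [z [z1 [z_init st z1_final]]]; exists (oglob z), (nglob z).
have [gr gr'] := asteps_glob st.
case dz: (odelta (oglob z).1 (oglob z).2) => [[q b] m]; exists b, m.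
have [nh ->] : ~~ ohalting (oglob z).1 /\ q = (nglob z).1.
  case: r r' r0 st {gr gr'} => // s r [|t r'] // _ [z2 + _].
  by rewrite /astep dz => /and5P[_ _ _ _ /and4P[_ -> /eqP ->]].
have trA := @asteps_track trackA carryA _ _ _ _ _ _ _ dz _ st.
have trB := @asteps_track trackB carryB _ _ _ _ _ _ _ dz _ st.
have trC := @asteps_track trackC carryC _ _ _ _ _ _ _ dz _ st.
have [e1 e2] := asteps_params st.
have ez : oglob z1 = oglob z by rewrite /oglob e1.
split=> //; rewrite /row_tape.
have hA : slots_ok (oglob z).2 b m false (spell trackA r) (spell trackA r') (enterB z).
  move: z_init z1_final => /and3P[/negPf <- _ _] /and3P[/eqP].
  rewrite /enterB e2 => <- _ _; apply: trA => z' s t z''; rewrite ez => ez'.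
  by rewrite /astep ez' dz; case/and5P=> _ _ _ _ /and5P[_ _ _ -> ].
have hB : slots_ok (oglob z).2 b m (enterB z) (spell trackB r) (spell trackB r') (enterC z).
  move: z_init z1_final => /and3P[_ /eqP <- _] /and3P[_ /eqP].
  rewrite /enterC e2 => <- _; apply: trB => z' s t z''; rewrite ez => ez'.
  by rewrite /astep ez' dz; case/and5P=> _ _ _ _ /and5P[_ _ _ _ /andP[->]].
have hC : slots_ok (oglob z).2 b m (enterC z) (spell trackC r) (spell trackC r') false.
  move: z_init z1_final => /and3P[_ _ /eqP <-] /and3P[_ _ /negPf <-].
  apply: trC => z' s t z''; rewrite ez => ez'.
  by rewrite /astep ez' dz; case/and5P=> _ _ _ _ /and5P[_ _ _ _ /andP[_ ->]].
rewrite slots_ok_cat; last by rewrite (slots_ok_size hA).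
apply/existsP; exists (enterB z); rewrite hA /=.
rewrite slots_ok_cat; last by rewrite (slots_ok_size hB).
by apply/existsP; exists (enterC z); rewrite hB hC.
Qed.

(** The new tape is cut at the borders of the old letters; as sizes are preserved, each piece
    respects the bound on tracks and is a track again. *)
Lemma asteps_complete (g g' : glob) b m r xA xB xC yA yB yC nA nB nC eB eC :
  odelta g.1 g.2 = (g'.1, b, m) -> ~~ ohalting g.1 ->
  all (fun s => letter_glob s == g) r ->
  slots_ok g.2 b m xA (spell trackA r) nA yA ->
  slots_ok g.2 b m xB (spell trackB r) nB yB ->
  slots_ok g.2 b m xC (spell trackC r) nC yC ->
  exists r', [/\ asteps (g, g', (xA, xB, xC), (eB, eC)) r r'
      (g, g', (yA, yB, yC), (eB, eC)),
    spell trackA r' = nA, spell trackB r' = nB & spell trackC r' = nC].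
Proof.
move=> dg nh; elim: r xA xB xC nA nB nC => [|s r IH] xA xB xC nA nB nC /=.
  move=> _ hA hB hC; exists [::]; move: hA hB hC.
  rewrite /spell /= => hA hB hC.
  have nil n x y : slots_ok g.2 b m x [::] n y -> n = [::].
    by move/slots_ok_size/size0nil.
  move: (nil _ _ _ hA) (nil _ _ _ hB) (nil _ _ _ hC) => ? ? ?; subst.
  by move: hA hB hC; rewrite !slots_ok_nil => /eqP -> /eqP -> /eqP ->.
move=> /andP[/eqP gs gr].
move=> /slots_ok_split [nA1 [nA2 [zA [-> hA1 hA2]]]].
move=> /slots_ok_split [nB1 [nB2 [zB [-> hB1 hB2]]]].
move=> /slots_ok_split [nC1 [nC2 [zC [-> hC1 hC2]]]].
have [r' [st' eA eB' eC']] := IH _ _ _ _ _ _ gr hA2 hB2 hC2.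
have bd (t : track) x n y : slots_ok g.2 b m x t n y -> size n <= track_bound.
  by move/slots_ok_size ->; apply: size_bseq.
pose t : letter := (g', letter_last s, (Bseq (bd _ _ _ _ hA1),
  Bseq (bd _ _ _ _ hB1), Bseq (bd _ _ _ _ hC1))).
exists (t :: r'); split; rewrite /spell /= -/(spell _ _) ?eA ?eB' ?eC' //.
exists (g, g', (zA, zB, zC), (eB, eC)) => //.
rewrite /astep /oglob /nglob /= dg gs nh !eqxx /=.
by rewrite /carryA /carryB /carryC /= hA1 hB1 hC1.
Qed.

Lemma row_step_complete (g g' : glob) b m r n :
  odelta g.1 g.2 = (g'.1, b, m) -> ~~ ohalting g.1 ->
  all (fun s => letter_glob s == g) r ->
  slots_ok g.2 b m false (row_tape r) n false ->
  exists2 r', row_step r r' & row_tape r' = n /\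
    all (fun s => letter_glob s == g') r'.
Proof.
move=> dg nh gr /slots_ok_split [nA [n' [eB [-> hA]]]].
move=> /slots_ok_split [nB [nC [eC [-> hB hC]]]].
have [r' [st tA tB tC]] := asteps_complete eB eC dg nh gr hA hB hC.
exists r'.
  by eexists; eexists; split; [|exact: st|]; rewrite /ainit /afinal
    /carryA /carryB /carryC /enterB /enterC /= !eqxx.
by rewrite /row_tape tA tB tC; split=> //; have [_] := asteps_glob st.
Qed.

End Letters.

Section Runs.
Variable M : TM token.

Notation sym := (tape_sym M).
Notation letter := (letter M).
Notation astate := (astate M).
Notation ostate := (ostate M).

(** * Streams of rows *)

Definition row_end (z : astate) (s t : letter) : bool :=
  letter_last s && [exists z1, astep z s t z1 && afinal z1].

Definition anext (z : astate) (s t : letter) (z' : astate) : bool :=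
  if letter_last s then row_end z s t && ainit z' else astep z s t z'.

Definition accepting (z : astate) (s t : letter) : bool :=
  row_end z s t && ((letter_glob t).1 == Some (acc M)).

Fixpoint run (z : astate) (ps : seq (letter * letter)) : Prop :=
  match ps with
  | [::] => False
  | [:: (s, t)] => accepting z s t
  | (s, t) :: ps' => exists2 z', anext z s t z' & run z' ps'
  end.

Definition is_row (r : seq letter) : bool :=
  [seq letter_last s | s <- r] == rcons (nseq (size r).-1 false) true.

Lemma is_row_cons s r :
  is_row (s :: r) = if r is [::] then letter_last s else ~~ letter_last s && is_row r.
Proof.
rewrite /is_row; case: r => [|s' r] /=; rewrite eqseq_cons ?andbT.
  by case: letter_last.
by case: letter_last.
Qed.

Lemma run_cons z s t ps : ps != [::] ->
  run z ((s, t) :: ps) = exists2 z', anext z s t z' & run z' ps.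
Proof. by case: ps. Qed.

Lemma run_row_sound r r' ps z : is_row r -> size r' = size r ->
  run z (zip r r' ++ ps) ->
  (exists2 z1, asteps z r r' z1 & afinal z1) /\
  (if ps is [::] then exists2 t, t \in r' & (letter_glob t).1 == Some (acc M)
   else exists2 z', ainit z' & run z' ps).
Proof.
elim: r r' z => [|s r IH] [|t r'] z //; rewrite is_row_cons.
case: r r' IH => [|s' r] [|t' r'] // IH.
  move=> ls _; case: ps {IH} => [|p ps] /=.
    move=> /andP[/andP[_ /existsP[z1 /andP[st fin]]] at_].
    split; first by exists z1 => //; exists z1.
    by exists t; rewrite ?mem_head.
  move=> [z']; rewrite /anext ls => /andP[/andP[_ /existsP[z1 /andP[st fin]]] zi] rn.
  by split; [exists z1 => //; exists z1 | exists z'].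
move=> /andP[ls row] [sz].
have zc : zip [:: s, s' & r] [:: t, t' & r'] ++ ps =
    (s, t) :: (zip (s' :: r) (t' :: r') ++ ps) by [].
rewrite zc run_cons // => -[z' st rn] {zc}.
have [] := IH (t' :: r') z' row (congr1 S sz) rn.
move: st; rewrite /anext (negPf ls) => st [z1 sts fin] h; split.
  by exists z1 => //; exists z'.
by case: ps h {IH rn} => // -[u ut hu]; exists u; rewrite // inE ut orbT.
Qed.

Lemma run_row_complete r r' ps z z1 : is_row r -> asteps z r r' z1 -> afinal z1 ->
  (if ps is [::] then is_true (all (fun t => (letter_glob t).1 == Some (acc M)) r')
   else exists2 z', ainit z' & run z' ps) ->
  run z (zip r r' ++ ps).
Proof.
elim: r r' z => [|s r IH] [|t r'] z //; rewrite is_row_cons.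
move=> row [z2 st sts] fin; case: r r' IH row sts => [|s' r] [|t' r'] // IH.
  move=> /= ls e2; rewrite -{}e2 in fin; have re : row_end z s t.
    by rewrite /row_end ls; apply/existsP; exists z2; rewrite st fin.
  case: ps {IH} => [|p ps] /=; first by rewrite /accepting re andbT.
  by move=> [z' zi rn]; exists z' => //; rewrite /anext ls re.
move=> /andP[ls row] sts h.
have zc : zip [:: s, s' & r] [:: t, t' & r'] ++ ps =
    (s, t) :: (zip (s' :: r) (t' :: r') ++ ps) by [].
rewrite zc run_cons // {zc}; exists z2.
  by rewrite /anext (negPf ls).
apply: (IH (t' :: r')) => //.
by case: ps {IH} h => // /andP[].
Qed.

(** * Accepting computations on tapes *)

(** Computations confined to the given cells, since all rows have the same length. There is at least
    one step, because the automaton looks for the accepting state in the new letter of a pair. *)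
Inductive oaccepts : ostate -> seq sym -> sym -> seq sym -> Prop :=
  | oaccepts_last q L a R b m L' a' R' :
      ~~ ohalting q -> odelta q a = (Some (acc M), b, m) ->
      moved m b L R L' a' R' -> oaccepts q L a R
  | oaccepts_step q L a R q' b m L' a' R' :
      ~~ ohalting q -> odelta q a = (q', b, m) ->
      moved m b L R L' a' R' -> oaccepts q' L' a' R' -> oaccepts q L a R.

Lemma is_row_asteps z (r r' : seq letter) z1 : is_row r -> asteps z r r' z1 -> is_row r'.
Proof. by rewrite /is_row => row st; rewrite (asteps_last st) (asteps_size st). Qed.

Lemma run_last z ps : run z ps -> exists ps' s t, ps = rcons ps' (s, t) /\ letter_last s.
Proof.
elim: ps z => [|[s t] [|p ps] IH] z //.
  by move=> /andP[/andP[ls _] _]; exists [::], s, t.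
rewrite run_cons // => -[z' _ /IH [ps' [s' [t' [-> ls]]]]].
by exists ((s, t) :: ps'), s', t'.
Qed.

Lemma is_row_take_last (r : seq letter) l s r2 :
  is_row r -> r = rcons l s ++ r2 -> letter_last s -> r2 = [::].
Proof.
elim: l r => [|x l IH] [|y r] //; rewrite is_row_cons => row [ey er].
  by rewrite -ey => ls; case: r row er => [|s' r] // /andP[/negP].
case: r row er => [|s' r]; first by case: l {IH}.
by move=> /andP[_ row] er; apply: IH row er.
Qed.

Lemma glob_state (r : seq letter) q g : r != [::] ->
  all (fun s => (letter_glob s).1 == q) r -> all (fun s => letter_glob s == g) r ->
  q = g.1.
Proof. by case: r => // s r _ /andP[/eqP <- _] /andP[/eqP -> _]. Qed.

(** [ss] is [ts] delayed by the row [r]. Once [r] has been compared with the first row [r'] of [ts],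
    the rest is in the same situation with [r'] in place of [r], whence induction on the size of
    [ts]. *)
Lemma run_sound r ts ss e z q L a R : is_row r ->
  all (fun s => (letter_glob s).1 == q) r -> row_tape r = tape L a R ->
  ainit z -> run z (zip ss ts) -> size ts = size ss -> r ++ ts = ss ++ e ->
  oaccepts q L a R.
Proof.
have [n] := ubnP (size ts); elim: n => // n IH in r ts ss z q L a R *.
move=> lt_n row qr tr zi rn sz eq_s.
have r0 : r != [::] by apply/eqP => r0; move: row; rewrite r0.
have le_sz : size r <= size ss.
  (* Otherwise the run would stop strictly inside [r]; but it stops at a letter flagged as the last
     one of a row. *)
  rewrite leqNgt; apply/negP => lt_sz.
  have [ps' [s [t [eps ls]]]] := run_last rn.
  have ess : ss = rcons (unzip1 ps') s.
    have : unzip1 (zip ss ts) = ss by rewrite unzip1_zip // sz.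
    by rewrite eps /unzip1 map_rcons /= => <-.
  have er : r = rcons (unzip1 ps') s ++ take (size r - size ss) e.
    have := congr1 (take (size r)) eq_s.
    by rewrite take_size_cat // take_cat ltnNge (ltnW lt_sz) /= ess.
  have r2 := is_row_take_last row er ls.
  by have := congr1 size er; rewrite r2 cats0 -ess => h; rewrite h ltnn in lt_sz.
have [ss' ess] : exists ss', ss = r ++ ss'.
  exists (drop (size r) ss); rewrite -{1}(cat_take_drop (size r) ss); congr (_ ++ _).
  have := congr1 (take (size r)) eq_s; rewrite take_size_cat // take_cat.
  case: ltnP => [_ //|le2]; have -> : size r = size ss by apply/eqP; rewrite eqn_leq le_sz.
  by rewrite subnn take0 cats0 take_size.
pose r' := take (size r) ts; pose ts' := drop (size r) ts.
have szr' : size r' = size r by rewrite size_takel // sz.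
have ets : ts = r' ++ ts' by rewrite cat_take_drop.
have sz' : size ts' = size ss' by rewrite size_drop sz ess size_cat addKn.
move: rn; rewrite ess ets zip_cat // => rn.
have [[z1 st fin] nxt] := run_row_sound row szr' rn.
have stp : row_step r r' by exists z, z1.
have [g [g' [b [m [gr gr' nh dg]]]]] := row_step_sound r0 stp.
have qg : q = g.1.
  exact: glob_state r0 qr gr.
rewrite tr => /slots_ok_tapeP [eg [L' [a' [R' [tr' mv]]]]].
rewrite qg; rewrite -qg in nh dg; case: ts' sz' rn nxt ets => [|t ts'] sz' rn nxt ets.
  have := esym (size0nil (esym sz')) => ess'; move: nxt; rewrite -ess' /= => -[t tr0 /eqP ta].
  have := allP gr' _ tr0 => /eqP tg; rewrite -qg.
  by apply: oaccepts_last nh _ mv; rewrite -eg dg -tg ta.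
case: ss' sz' rn nxt ess => [|s ss'] // sz' rn [z' zi' rn'] ess.
rewrite -qg; apply: oaccepts_step nh _ mv _; first by rewrite -eg dg.
apply: (IH r' (t :: ts') (s :: ss') z') => //.
- rewrite -ltnS (leq_trans _ lt_n) // ets size_cat szr' ltnS -[X in X < _]add0n ltn_add2r.
  by rewrite lt0n size_eq0.
- exact: is_row_asteps row st.
- by apply/allP => x /(allP gr') /eqP ->.
move: eq_s; rewrite ess -catA ets => /eqP; rewrite eqseq_cat // eqxx /= => /eqP ->.
by [].
Qed.

Lemma run_complete r q L a R : oaccepts q L a R -> is_row r ->
  all (fun s => letter_glob s == (q, a)) r -> row_tape r = tape L a R ->
  exists ts ss e z, [/\ ainit z, run z (zip ss ts), size ts = size ss & r ++ ts = ss ++ e].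
Proof.
move=> acc_q; elim: acc_q r => {q L a R}
  [q L a R b m L' a' R' nh dq mv|q L a R q' b m L' a' R' nh dq mv _ IH] r row gr tr.
- have ok := slots_ok_tape a mv; rewrite -tr in ok.
  have [r' [z [z1 [zi st fin]]] [tr' gr']] :=
    @row_step_complete M (q, a) (Some (acc M), a') b m r _ dq nh gr ok.
  exists r', r, r', z; split=> //; last exact: asteps_size st.
  rewrite -[zip _ _]cats0; apply: run_row_complete row st fin _.
  by apply/allP => t /(allP gr') /eqP ->.
- have ok := slots_ok_tape a mv; rewrite -tr in ok.
  have [r' [z [z1 [zi st fin]]] [tr' gr']] :=
    @row_step_complete M (q, a) (q', a') b m r _ dq nh gr ok.
  have [ts [ss [e [z' [zi' rn sz eq_s]]]]] := IH r' (is_row_asteps row st) gr' tr'.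
  exists (r' ++ ts), (r ++ ss), e, z; split=> //.
  + rewrite zip_cat ?(asteps_size st) //; apply: run_row_complete row st fin _.
    by case: (zip ss ts) rn => // p ps rn; exists z'.
  + by rewrite !size_cat sz (asteps_size st).
  + by rewrite eq_s catA.
Qed.

(** A row shows blanks that the configuration leaves implicit. *)
Definition related (c : config M) (L : seq sym) (a : sym) (R : seq sym) : Prop :=
  exists i j, L = tleft c ++ nseq i (blank M) /\
    a :: R = tright c ++ nseq j (blank M).

Lemma behead_padded (x : sym) y s i : x :: s = y ++ nseq i (blank M) ->
  x = head (blank M) y /\ exists j, s = behead y ++ nseq j (blank M).
Proof.
case: y => [|u y] /=; last by case=> -> ->; split=> //; exists i.
by case: i => [|i] //= [-> ->]; split=> //; exists i.
Qed.

Lemma related_step c L a R q' b m L' a' R' :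
  related c L a R -> ~~ halting (cstate c) ->
  odelta (Some (cstate c)) a = (q', b, m) -> moved m b L R L' a' R' ->
  q' = Some (cstate (step c)) /\ related (step c) L' a' R'.
Proof.
move=> [i [j [eL /behead_padded [ea [k eR]]]]] nh; rewrite /step.
move: nh; rewrite /halting => /negPf -> /=; rewrite -ea.
case: delta => -[q1 b1] m1 [<- <- <-]; case: m1 => /=.
- move=> [eL' ->]; rewrite eL' in eL; have [-> [i' ->]] := behead_padded eL.
  by split=> //; exists i', k; rewrite eR.
- by move=> [-> -> ->]; split=> //; exists i, k; rewrite eL eR.
- move=> [eR' ->]; rewrite eR' in eR; split=> //.
  by exists i, k; rewrite eL.
Qed.

Lemma oaccepts_accepts c L a R : oaccepts (Some (cstate c)) L a R ->
  related c L a R -> exists n, cstate (iter n (@step _ M) c) = acc M.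
Proof.
move eq: (Some _) => q ac; elim: ac c eq => {q L a R}
  [q L a R b m L' a' R' nh dq mv|q L a R q' b m L' a' R' nh dq mv _ IH] c eq rc.
- rewrite -eq in nh dq; have [[ea] _] := related_step rc nh dq mv.
  by exists 1; rewrite /= -ea.
- rewrite -eq in nh dq; have [ea rc'] := related_step rc nh dq mv.
  by have [n hn] := IH _ (esym ea) rc'; exists n.+1; rewrite iterSr.
Qed.

(** The head moves by at most one cell per step, so margins of more than [n] cells keep it on the
    tape for all [n.+1] steps. *)
Lemma accepts_oaccepts n c L a R :
  cstate (iter n.+1 (@step _ M) c) = acc M ->
  (forall m, m <= n -> ~~ halting (cstate (iter m (@step _ M) c))) ->
  related c L a R -> n < size L -> n < size R ->
  oaccepts (Some (cstate c)) L a R.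
Proof.
elim: n c L a R => [|n IH] c L a R ac nh rc szL szR.
all: case dq: (odelta (Some (cstate c)) a) => [[q' b] m].
all: have [L' [a' [R' [mv szL' szR']]]] : exists L' a' R',
  [/\ moved m b L R L' a' R', (size L).-1 <= size L' & (size R).-1 <= size R'].
1,3: case: m dq => dq;
  [ case: L {rc} szL => // a' L _; exists L, a', (b :: R); split=> //=;
    apply: (leq_trans (leq_pred _)) => //
  | exists L, b, R; split=> //; exact: leq_pred
  | case: R {rc} szR => // a' R _; exists (b :: L), a', R; split=> //=;
    apply: (leq_trans (leq_pred _)) => // ].
all: have nh0 : ~~ ohalting (Some (cstate c)) := nh 0 isT.
all: have [eq' rc'] := related_step rc nh0 dq mv.
  apply: oaccepts_last nh0 _ mv; rewrite dq eq'.
  by rewrite /= in ac; rewrite ac.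
apply: oaccepts_step nh0 dq mv _; rewrite eq'; apply: IH => //.
- by rewrite -iterSr.
- by move=> k le_kn; rewrite -iterSr; apply: nh.
- by apply: leq_trans szL'; case: (size L) szL.
- by apply: leq_trans szR'; case: (size R) szR.
Qed.

End Runs.

(** * The initial row *)

Section InitialRow.
Variable M : TM token.

Notation sym := (tape_sym M).
Notation letter := (letter M).
Notation track := (track M).

Definition empty_track : track := [bseq].
Definition single_track (s : slot M) : track := @Bseq _ _ [:: s] (ltn0Sn _).

Lemma block_track_proof (x : datum) :
  size [seq (inp M t, false) | t <- block x] <= track_bound.
Proof. by rewrite size_map size_block. Qed.

Definition block_track (x : datum) : track := Bseq (block_track_proof x).

Definition initial_glob : glob M := (None, blank M).

Definition left_pad (head_here : bool) : letter :=
  (initial_glob, false, (single_track (blank M, head_here), empty_track, empty_track)).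

Definition right_pad (is_last : bool) : letter :=
  (initial_glob, is_last, (empty_track, empty_track, single_track (blank M, false))).

(** No datum carries the head, which starts on the padding in the extra initial state. Hence the
    letter depends on the datum alone and not on its position, so one node per datum is enough. *)
Definition datum_letter (x : datum) : letter :=
  (initial_glob, false,
    (if x.2 then empty_track else single_track (inp M x.1, false), block_track x,
     if x.2 then single_track (inp M x.1, false) else empty_track)).

Definition initial_row (us : seq datum) (k k' : nat) : seq letter :=
  nseq k (left_pad false) ++ left_pad true :: map datum_letter us ++
  rcons (nseq k' (right_pad false)) (right_pad true).

Lemma initial_is_row us k k' : is_row (initial_row us k k').
Proof.
rewrite /is_row /initial_row -cat_cons catA -rcons_cat map_rcons size_rcons /=.
apply/eqP; congr (rcons _ _); rewrite -(size_map (@letter_last M)).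
apply/all_pred1P; rewrite all_map.
rewrite !all_cat /= all_map; apply/andP; split; last by apply/allP=> _ /nseqP[->].
by rewrite all_nseq orbT /=; apply/allP.
Qed.

Lemma initial_row_glob us k k' :
  all (fun s => letter_glob s == initial_glob) (initial_row us k k').
Proof.
rewrite /initial_row all_cat /= all_cat all_rcons !all_nseq all_map.
by rewrite /letter_glob /= !eqxx !orbT !andbT; apply/allP => x _ /=; rewrite eqxx.
Qed.

Lemma spell_cat (tr : letter -> seq (slot M)) r1 r2 :
  spell tr (r1 ++ r2) = spell tr r1 ++ spell tr r2.
Proof. by rewrite /spell map_cat flatten_cat. Qed.

Lemma spell_nseq (tr : letter -> seq (slot M)) n l : spell tr (nseq n l) = flatten (nseq n (tr l)).
Proof. by rewrite /spell map_nseq. Qed.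

Lemma flatten_nseq_nil (T : Type) n : flatten (nseq n [::]) = [::] :> seq T.
Proof. by elim: n. Qed.

Lemma flatten_nseq1 (T : Type) n (x : T) : flatten (nseq n [:: x]) = nseq n x.
Proof. by elim: n => //= n ->. Qed.

Lemma initial_row_tape pre post k k' :
  row_tape (initial_row (spelled pre post) k k') =
  tape (nseq k (blank M)) (blank M)
    ([seq inp M t | t <- pre ++ flatten (map block (spelled pre post)) ++ post] ++
     nseq k'.+1 (blank M)).
Proof.
have spA : spell (@trackA M) (map datum_letter (spelled pre post)) =
    [seq (inp M t, false) | t <- pre].
  rewrite /spell /spelled !map_cat -!map_comp flatten_cat.
  rewrite [X in _ ++ X](_ : _ = [::]) ?cats0; last by elim: (post).
  by elim: (pre) => //= t p ->.
have spC : spell (@trackC M) (map datum_letter (spelled pre post)) =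
    [seq (inp M t, false) | t <- post].
  rewrite /spell /spelled !map_cat -!map_comp flatten_cat.
  rewrite [X in X ++ _](_ : _ = [::]) //=; first by elim: (post) => //= t p ->.
  by elim: (pre).
have spB : spell (@trackB M) (map datum_letter (spelled pre post)) =
    [seq (inp M t, false) | t <- flatten (map block (spelled pre post))].
  by elim: (spelled pre post) => //= x us IH; rewrite map_cat -IH.
rewrite /row_tape /initial_row -!cats1.
rewrite -(cat1s (left_pad true)) !spell_cat spA spB spC !spell_nseq.
rewrite /spell /trackA /trackB /trackC /= !flatten_nseq_nil !flatten_nseq1 /=.
rewrite !cats0 /tape rev_nseq map_nseq -!catA /=; congr (_ ++ _ :: _).
by rewrite !map_cat -!map_comp -!catA cats1 rcons_nseq /= map_nseq.
Qed.

(** For a computation with rows 0 to n, [ts] consists of rows 1 to n, [ss] of rows 0 to n-1, and [e]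
    is row n. In a tree, [e] is what is spelled by arbitrary letters after the disjunction. *)
Definition stream (us : seq datum) (k k' : nat) (ts ss : seq letter) : Prop :=
  exists e z, [/\ ainit z, run z (zip ss ts), size ts = size ss &
    initial_row us k k' ++ ts = ss ++ e].

Lemma oaccepts_start L a R : oaccepts None L a R ->
  start M = acc M \/ exists a' R', R = a' :: R' /\ oaccepts (Some (start M)) (a :: L) a' R'.
Proof.
move eq: None => q ac; case: ac eq => {q L a R}
  [q L a R b m L' a' R' _ dq _|q L a R q' b m L' a' R' _ dq mv ac] eq;
  rewrite -eq in dq; case: dq.
  by move=> ->; left.
by move=> e1 e2 e3; move: mv ac; rewrite -e1 -e2 -e3 => -[-> ->] ac; right; exists a', R'.
Qed.

Lemma stream_accepts pre post k k' ts ss : stream (spelled pre post) k k' ts ss ->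
  accepts M (pre ++ flatten (map block (spelled pre post)) ++ post).
Proof.
move=> [e [z [zi rn sz eq_s]]].
have gl : all (fun s => (letter_glob s).1 == None) (initial_row (spelled pre post) k k').
  by apply/allP => s /(allP (initial_row_glob _ _ _)) /eqP ->.
have [sa|[a [R [eR ac]]]] := oaccepts_start
    (run_sound (initial_is_row _ _ _) gl (initial_row_tape _ _ _ _) zi rn sz eq_s).
  by exists 0.
apply: (oaccepts_accepts (c := init M _) ac).
by exists k.+1, k'.+1; rewrite eR.
Qed.

Lemma accepts_stream pre post :
  accepts M (pre ++ flatten (map block (spelled pre post)) ++ post) ->
  exists k k' ts ss, stream (spelled pre post) k k' ts ss.
Proof.
set w := pre ++ _ => /accepts_nonhalting [n ac nh].
suff [k [k' ac']] : exists k k', oaccepts None (nseq k (blank M)) (blank M)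
    ([seq inp M t | t <- w] ++ nseq k'.+1 (blank M)).
  have [ts [ss [e [z h]]]] := run_complete ac' (initial_is_row (spelled pre post) k k')
    (initial_row_glob _ _ _) (initial_row_tape _ _ _ _).
  by exists k, k', ts, ss, e, z.
(* In [n] steps the head strays at most [n] cells from its start, so padding of this length
   suffices. *)
exists n, n.
have [a' [R' eR]] : exists a' R', [seq inp M t | t <- w] ++ nseq n.+1 (blank M) = a' :: R'.
  by case: w {ac nh} => [|t w] /=; do 2 eexists.
have mv : moved MoveR (blank M) (nseq n (blank M)) ([seq inp M t | t <- w] ++ nseq n.+1 (blank M))
    (nseq n.+1 (blank M)) a' R' by [].
(* If the start state accepts, the single step out of the extra initial state is the whole
   computation. *)
case: n => [|n] in ac nh eR mv *.
  have sa : start M = acc M := ac.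
  by apply: oaccepts_last mv => //=; rewrite sa.
apply: oaccepts_step mv _ => //; apply: (accepts_oaccepts (c := init M w) ac) => //.
- by exists n.+2, n.+2; rewrite -eR.
- by rewrite size_nseq.
- have := congr1 size eR; rewrite size_cat size_nseq /= => e.
  by rewrite -ltnS -e addnS ltnS leq_addl.
Qed.

End InitialRow.

(** * The TBoxes *)

Section Graph.
Variable M : TM token.

Notation letter := (letter M).
Notation astate := (astate M).

(* The names that queries can see on anonymous elements. *)
Inductive vis : Type := VI | VE | VL of letter.

Definition vis_code (v : vis) : option (option letter) :=
  match v with VI => None | VE => Some None | VL l => Some (Some l) end.
Definition vis_decode (c : option (option letter)) : vis :=
  match c with None => VI | Some None => VE | Some (Some l) => VL l end.
Lemma vis_codeK : cancel vis_code vis_decode.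
Proof. by case. Qed.
HB.instance Definition _ := Finite.copy vis (can_type vis_codeK).

(* An element of kind [(e, o, l)] is at an even distance below some I-element
   iff [e], and at an odd distance iff [o], counting only paths on which every
   element at an odd distance (but the last) has a letter; [l] tells whether the
   element itself has letters. *)
Definition kind : Type := (bool * bool * bool)%type.

Definition kind_even (k : kind) : bool := k.1.1.
Definition kind_odd (k : kind) : bool := k.1.2.
Definition kind_letter (k : kind) : bool := k.2.

Definition kind_shows (k : kind) (v : vis) : bool :=
  match v with
  | VI => kind_even k
  | VE => ~~ kind_even k && ~~ kind_odd k
  | VL _ => kind_letter k
  end.

(** The even flag is only bounded from below: an element may be an I-element itself and so begin a
    path of length zero. *)
Definition kind_child (k k' : kind) : bool :=
  (kind_odd k' == kind_even k) &&
  (kind_odd k && kind_letter k ==> kind_even k').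

Inductive node : Type :=
  | Kind of kind
  | Start | LeftPad of bool | LeftGap | Literal | Datum of datum | AfterLiteral
  | RightPad of bool | RowGap
  | NewLetter of astate & letter & bool
  | OldLetter of astate & letter & letter
  | Choice | Finish | Gap | AnyLetter | LateFinish.

Definition node_sum : Type :=
  (kind + datum + (astate * letter * bool) + (astate * letter * letter) + 'I_14)%type.

Definition node_code (s : node) : node_sum :=
  match s with
  | Kind k => inl (inl (inl (inl k)))
  | Datum x => inl (inl (inl (inr x)))
  | NewLetter z t b => inl (inl (inr (z, t, b)))
  | OldLetter z t s => inl (inr (z, t, s))
  | Start => inr (@Ordinal 14 0 isT)
  | LeftPad false => inr (@Ordinal 14 1 isT)
  | LeftPad true => inr (@Ordinal 14 2 isT)
  | LeftGap => inr (@Ordinal 14 3 isT)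
  | Literal => inr (@Ordinal 14 4 isT)
  | AfterLiteral => inr (@Ordinal 14 5 isT)
  | RightPad false => inr (@Ordinal 14 6 isT)
  | RightPad true => inr (@Ordinal 14 7 isT)
  | RowGap => inr (@Ordinal 14 8 isT)
  | Choice => inr (@Ordinal 14 9 isT)
  | Finish => inr (@Ordinal 14 10 isT)
  | Gap => inr (@Ordinal 14 11 isT)
  | AnyLetter => inr (@Ordinal 14 12 isT)
  | LateFinish => inr (@Ordinal 14 13 isT)
  end.

Definition node_decode (c : node_sum) : node :=
  match c with
  | inl (inl (inl (inl k))) => Kind k
  | inl (inl (inl (inr x))) => Datum x
  | inl (inl (inr (z, t, b))) => NewLetter z t b
  | inl (inr (z, t, s)) => OldLetter z t s
  | inr i => nth LateFinish [:: Start; LeftPad false; LeftPad true; LeftGap; Literal;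
      AfterLiteral; RightPad false; RightPad true; RowGap; Choice; Finish; Gap; AnyLetter] i
  end.

Lemma node_codeK : cancel node_code node_decode.
Proof. by case=> // -[]. Qed.

HB.instance Definition _ := Finite.copy node (can_type node_codeK).

Definition shows (s : node) (v : vis) : bool :=
  match s with
  | Kind k => kind_shows k v
  | Start => v == VI
  | LeftPad b => v == VL (left_pad M b)
  | Datum x => v == VL (datum_letter M x)
  | RightPad b => v == VL (right_pad M b)
  | NewLetter _ t b => (v == VL t) || b && (v == VI)
  | OldLetter _ _ s => v == VL s
  | Finish | LateFinish => v == VE
  | AnyLetter => if v is VL _ then true else false
  | _ => false
  end.

(* At odd distances from [Start] are the letters of the rows, at even ones the
   letters of the preceding rows or, along the initial row, gaps. *)
Definition child (s s' : node) : bool :=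
  match s, s' with
  | Kind k, Kind k' => kind_child k k'
  | Start, LeftPad _ => true
  | LeftPad false, LeftGap => true
  | LeftGap, LeftPad _ => true
  | LeftPad true, Literal => true
  | AfterLiteral, RightPad _ => true
  | RightPad false, AfterLiteral => true
  | RightPad true, RowGap => true
  | RowGap, NewLetter z _ b => b && ainit z
  | NewLetter z t _, OldLetter z' t' _ => (z == z') && (t == t')
  | OldLetter z t s, NewLetter z' _ b => ~~ b && anext z s t z'
  | OldLetter z t s, Choice => accepting z s t
  | Gap, AnyLetter => true
  | AnyLetter, Gap => true
  | Gap, LateFinish => true
  | _, _ => false
  end.

Definition is_kind (s : node) : bool := if s is Kind _ then true else false.

(** Numbers below 23 are taken by [A_name], [I_name], [E_name], the gates and the data; from there
    on letters get odd numbers and nodes even ones. *)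
Definition vis_name (v : vis) : cname :=
  match v with
  | VI => I_name
  | VE => E_name
  | VL l => 23 + (enum_rank l).*2
  end.

Definition node_name (s : node) : cname :=
  if s is Datum x then datum_name x else 24 + (enum_rank s).*2.

Lemma vis_name_inj : injective vis_name.
Proof.
by move=> [||l] [||l'] //= /addnI /double_inj /val_inj /enum_rank_inj ->.
Qed.

Variant node_name_spec (s : node) : cname -> Prop :=
  | DatumName x of s = Datum x : node_name_spec s (datum_name x)
  | RankName : node_name_spec s (24 + (enum_rank s).*2).

Lemma node_nameP s : node_name_spec s (node_name s).
Proof. by rewrite /node_name; case: s => *; constructor. Qed.

Lemma node_name_inj : injective node_name.
Proof.
have small x (s : node) : datum_name x <> 24 + (enum_rank s).*2.
  by move=> e; have := datum_name_bounds x; rewrite e => /andP[_]; rewrite ltnNge.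
move=> s s'; case: node_nameP => [x ->|]; case: node_nameP => [x' ->|].
- by move/datum_name_inj ->.
- by move/small.
- by move/esym/small.
- by move=> /addnI /double_inj /val_inj /enum_rank_inj.
Qed.

Lemma node_name_bound s : 5 <= node_name s.
Proof. by case: node_nameP => // x _; case/andP: (datum_name_bounds x). Qed.

Lemma node_vis_name s v : node_name s <> vis_name v.
Proof.
case: v => [||l] /= e; try by have := node_name_bound s; rewrite e.
move: e; case: node_nameP => [x _ e|].
  by have := datum_name_bounds x; rewrite e => /andP[_]; rewrite ltnNge leq_addr.
by move/(congr1 odd); rewrite !oddD !odd_double.
Qed.

Lemma vis_name_range v : vis_name v \notin [:: A_name; gate1; gate2].
Proof. by case: v. Qed.

Lemma node_name_range s : node_name s \notin [:: A_name; gate1; gate2].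
Proof.
by have := node_name_bound s; case: (node_name s) => [|[|[|[|[|n]]]]].
Qed.

Definition named (I : interp) (gate : cname) (s : node) (d : dom I) : Prop :=
  cint gate d /\ cint (node_name s) d.

Definition gated (gate : cname) (s : node) : concept :=
  And (Name gate) (Name (node_name s)).

Definition graph_axioms (gate : cname) (P : pred node) : tbox :=
  [seq (gated gate p.1, Name (vis_name p.2)) |
    p <- enum {: node * vis} & P p.1 && shows p.1 p.2] ++
  [seq (gated gate p.1, Ex R_role (gated gate p.2)) |
    p <- enum {: node * node} & P p.1 && child p.1 p.2].

(** Inside its tree a root is reached only by the path of length zero, so its odd flag must be
    false, while it may or may not be an I-element. *)
Definition root_axioms (gate : cname) (r : rname) : tbox :=
  [seq (Name A_name, Ex r (gated gate (Kind k))) | k <- enum {: kind} & ~~ kind_odd k].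

Definition horn_tbox (r : rname) : tbox :=
  (Name gate2, Neg Top) :: root_axioms gate1 r ++ graph_axioms gate1 is_kind.

(** The only inclusion that is not Horn: the disjunction of [Finish] and [Gap]. *)
Definition choice_axiom : inclusion :=
  (gated gate2 Choice,
   Neg (And (Neg (Name (node_name Finish))) (Neg (Name (node_name Gap))))).

Definition alc_rest (r : rname) : tbox :=
  (Name gate1, Neg Top) :: choice_axiom :: (Name A_name, Ex r (gated gate2 Start)) ::
  root_axioms gate2 r ++ graph_axioms gate2 predT.

Definition alc_tbox (r : rname) (us : seq datum) : tbox :=
  (gated gate2 Literal, chain (gated gate2 AfterLiteral) us) :: alc_rest r.

Definition query_sig : finsig :=
  [:: inl A_name, inr R_role & [seq inl (vis_name v) | v <- enum {: vis}]].

Definition encoding_before (r : rname) : seq token :=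
  enc_tbox (horn_tbox r) ++ TCons :: enc_concept (gated gate2 Literal).

Definition encoding_after (r : rname) (tail : seq token) : seq token :=
  enc_concept (gated gate2 AfterLiteral) ++ enc_tbox (alc_rest r) ++ tail.

Definition self_data (r : rname) (tail : seq token) : seq datum :=
  spelled (encoding_before r) (encoding_after r tail).

Lemma enc_self r tail (us := self_data r tail) :
  enc_tbox (horn_tbox r) ++ enc_tbox (alc_tbox r us) ++ tail =
  encoding_before r ++ flatten (map block us) ++ encoding_after r tail.
Proof.
have -> : enc_tbox (alc_tbox r us) =
    TCons :: (enc_concept (gated gate2 Literal) ++
      enc_concept (chain (gated gate2 AfterLiteral) us)) ++ enc_tbox (alc_rest r) by [].
by rewrite enc_chain /encoding_before /encoding_after -!catA cat_cons -!catA.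
Qed.

(** * Models of the TBoxes *)

Lemma tbox_sat_cons I ci T :
  tbox_sat I (ci :: T) <->
  (forall d : dom I, ceval ci.1 d -> ceval ci.2 d) /\ tbox_sat I T.
Proof.
split=> [h|[h1 h2] ci' [<-|]] //; last exact: h2.
by split=> [|ci' ci'T]; apply: h; [left | right].
Qed.

Lemma tbox_sat_cat I T1 T2 : tbox_sat I (T1 ++ T2) <-> tbox_sat I T1 /\ tbox_sat I T2.
Proof.
split=> [h|[h1 h2] ci /In_cat[]]; last exact: h2; last exact: h1.
by split=> ci ciT; apply: h; apply/In_cat; [left | right].
Qed.

Lemma tbox_sat_map (T : eqType) (f : T -> inclusion) I s :
  tbox_sat I (map f s) <->
  forall x, x \in s -> forall d : dom I, ceval (f x).1 d -> ceval (f x).2 d.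
Proof.
split=> [h x xs d|h ci /In_map[x /InP xs ->]]; last exact: h.
by apply: h; apply/In_map; exists x => //; apply/InP.
Qed.

Lemma graph_axioms_sat I gate P :
  tbox_sat I (graph_axioms gate P) <->
  (forall s v (d : dom I), P s -> shows s v -> named gate s d -> cint (vis_name v) d) /\
  (forall s s' (d : dom I), P s -> child s s' -> named gate s d ->
    exists2 e, rint R_role d e & named gate s' e).
Proof.
rewrite tbox_sat_cat !tbox_sat_map; split=> [[h1 h2]|[h1 h2]]; split.
- move=> s v d Ps sv; apply: (h1 (s, v)).
  by rewrite mem_filter Ps sv mem_enum.
- move=> s s' d Ps ss' nd.
  have in_ss' : (s, s') \in [seq p <- enum {: node * node} | P p.1 && child p.1 p.2].
    by rewrite mem_filter Ps ss' mem_enum.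
  by have [e [de ne]] := h2 _ in_ss' d nd; exists e.
- move=> [s v]; rewrite mem_filter /= => /andP[/andP[Ps sv] _] d.
  exact: h1.
- move=> [s s']; rewrite mem_filter /= => /andP[/andP[Ps ss'] _] d nd.
  by have [e de ne] := h2 _ _ _ Ps ss' nd; exists e.
Qed.

Lemma root_axioms_sat I gate r :
  tbox_sat I (root_axioms gate r) <->
  forall k (a : dom I), ~~ kind_odd k -> cint A_name a ->
    exists2 e, rint r a e & named gate (Kind k) e.
Proof.
rewrite tbox_sat_map; split=> [h k a ko Aa|h k].
  have in_k : k \in [seq k' <- enum {: kind} | ~~ kind_odd k'].
    by rewrite mem_filter ko mem_enum.
  by have [e [ae ne]] := h _ in_k a Aa; exists e.
rewrite mem_filter => /andP[ko _] a Aa.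
by have [e ae ne] := h k a ko Aa; exists e.
Qed.

Lemma occurs_nameE C p A : occurs C p (Name A) -> C = Name A.
Proof. by move=> h; inversion h. Qed.

Lemma occurs_gatedE C p gate s : occurs C p (gated gate s) ->
  C = gated gate s \/ exists A, C = Name A.
Proof.
move=> h; inversion h as [|p' D E h'|p' D E h'|p' R D h'|p' D h']; subst; first by left.
- by right; exists gate; apply: occurs_nameE h'.
- by right; exists (node_name s); apply: occurs_nameE h'.
Qed.

Lemma occurs_exE C p R D : occurs C p (Ex R D) -> C = Ex R D \/ occurs C p D.
Proof.
by move=> h; inversion h as [|p' D' E h'|p' D' E h'|p' R' D' h'|p' D' h']; subst;
  [left | right].
Qed.

Lemma occurs_neg_topE C p : occurs C p (Neg Top) -> C = Neg Top /\ p = true \/ C = Top.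
Proof.
move=> h; inversion h as [|p' D' E h'|p' D' E h'|p' R' D' h'|p' D' h']; subst; first by left.
by inversion h'; right.
Qed.

Lemma horn_horn_tbox r : horn (horn_tbox r).
Proof.
have shape ci : List.In ci (horn_tbox r) ->
  [\/ ci.2 = Neg Top, exists r' s, ci.2 = Ex r' (gated gate1 s) | exists A, ci.2 = Name A].
  rewrite /horn_tbox => -[<-|/In_cat[/In_map[k _ ->]|/In_cat[]/In_map[p _ ->]]].
  - exact: Or31.
  - by apply: Or32; exists r, (Kind k).
  - by apply: Or33; exists (vis_name p.2).
  - by apply: Or32; exists R_role, p.2.
have shape1 ci : List.In ci (horn_tbox r) ->
  (exists A, ci.1 = Name A) \/ (exists s, ci.1 = gated gate1 s).
  rewrite /horn_tbox => -[<-|/In_cat[/In_map[k _ ->]|/In_cat[]/In_map[p _ ->]]].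
  - by left; exists gate2.
  - by left; exists A_name.
  - by right; exists p.1.
  - by right; exists p.1.
have lhs ci C p : List.In ci (horn_tbox r) -> occurs C p ci.1 ->
    (exists A, C = Name A) \/ exists s, C = gated gate1 s.
  move=> /shape1[[A ->] /occurs_nameE ->|[s ->] /occurs_gatedE[->|]].
  - by left; exists A.
  - by right; exists s.
  - by left.
split=> [C|R C] [ci ci_in [/(lhs _ _ _ ci_in)[[A]|[s]] //|]];
  case: (shape ci ci_in) => [->|[r' [s ->]]|[A ->]].
- by move/occurs_neg_topE => [[]|].
- by move/occurs_exE => [//|/occurs_gatedE[|[]]].
- by move/occurs_nameE.
- by move/occurs_neg_topE => [[]|].
- by move/occurs_exE => [[_]|/occurs_gatedE[|[]]].
- by move/occurs_nameE.
Qed.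

End Graph.

Section Forest.
Variable M : TM token.

Notation node := (node M).

(** * Forest models *)

(* The elements of the literal chain carry the rest of the spelled word, and an
   element named [Choice] carries the disjunct that it satisfies. *)
Inductive tnode : Type :=
  | Plain of node
  | DatumAt of datum & seq datum
  | GapAt of seq datum
  | ChoiceAt of bool.

Variables (us : seq datum) (r : rname) (ab : abox) (gate : cname) (with_start : bool).
Variable choice : iname -> seq tnode -> bool.

Definition has_name (t : tnode) (s : node) : Prop :=
  match t with
  | Plain s' =>
    match s' with Literal | AfterLiteral | Datum _ | Choice => False | _ => s' = s end
  | DatumAt x _ => s = Datum M x
  | GapAt l => s = Literal M /\ l = us \/ s = AfterLiteral M /\ l = [::]
  | ChoiceAt b => s = Choice M \/ s = if b then Finish M else Gap M
  end.

Definition tshows (t : tnode) (v : vis M) : Prop :=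
  exists2 s, has_name t s & shows s v.

(** An element [ChoiceAt false] also bears the name [Gap]; the last condition keeps an edge towards
    [Gap] from leading to it. *)
Definition tchild (t t' : tnode) : Prop :=
  (exists s s', [/\ has_name t s, child s s', has_name t' s' &
    if t' is ChoiceAt _ then s' = Choice M else True]) \/
  match t, t' with
  | GapAt (x :: l), DatumAt y l' => x = y /\ l = l'
  | DatumAt _ l, GapAt l' => l = l'
  | _, _ => False
  end.

Definition choice_ok (a : iname) (p : seq tnode) (t : tnode) : Prop :=
  if t is ChoiceAt b then b = choice a p else True.

Definition root (t : tnode) : Prop :=
  (exists2 k, ~~ kind_odd k & t = Plain (Kind M k)) \/ with_start /\ t = Plain (Start M).

(* Elements are identified with the reversed path that leads to them. *)
Fixpoint live (a : iname) (p : seq tnode) : Prop :=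
  match p with
  | [::] => False
  | [:: t] => List.In (CAssert A_name a) ab /\ root t
  | t :: (t' :: _) as p' => [/\ live a p', tchild t' t & choice_ok a p' t]
  end.

Definition forest_cint (B : cname) (d : iname + iname * seq tnode) : Prop :=
  match d with
  | inl a => List.In (CAssert B a) ab
  | inr (a, p) => live a p /\ (if p is t :: _ then
      [\/ B = gate, (exists2 s, has_name t s & B = node_name s) |
        (exists2 v, tshows t v & B = vis_name v)] else False)
  end.

Definition forest_rint (R : rname) (d e : iname + iname * seq tnode) : Prop :=
  match d, e with
  | inl a, inl b => List.In (RAssert R a b) ab
  | inl a, inr (b, p) => [/\ a = b, R = r, live b p & exists t, p = [:: t]]
  | inr (a, p), inr (b, p') =>
    [/\ a = b, R = R_role, live b p' & p <> [::] /\ exists t, p' = t :: p]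
  | inr _, inl _ => False
  end.

Definition forest : interp := Interp forest_cint forest_rint.

Hypothesis gateP : gate = gate1 \/ gate = gate2.
Hypothesis no_gate : forall a, ~ List.In (CAssert gate a) ab.

Lemma gate_node s : node_name (s : node) <> gate.
Proof.
by move=> e; have := node_name_range s; rewrite e !inE;
  case: gateP => ->.
Qed.

Lemma gate_vis v : vis_name (v : vis M) <> gate.
Proof.
by move=> e; have := vis_name_range v; rewrite e !inE; case: gateP => ->.
Qed.

Lemma forest_named s (d : dom forest) : named gate (s : node) d <->
  exists a t p, [/\ d = inr (a, t :: p), live a (t :: p) & has_name t s].
Proof.
split=> [[]|[a [t [p [-> lv ts]]]]]; last first.
  by split; split=> //; [constructor 1 | constructor 2; exists s].
case: d => [a /no_gate //|[a [|t p]]] /= [lv _] // [_ []].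
- by move/gate_node.
- by move=> [s' hs' /node_name_inj ->]; exists a, t, p.
- by move=> [v _ /node_vis_name].
Qed.

Lemma forest_vis v (a : iname) p :
  @cint forest (vis_name (v : vis M)) (inr (a, p)) ->
  live a p /\ exists t p', p = t :: p' /\ tshows t v.
Proof.
case: p => [|t p] /= [lv] // [/gate_vis //||].
- by move=> [s _ /esym /node_vis_name].
- by move=> [v' tv' /vis_name_inj ->]; split=> //; exists t, p.
Qed.

Lemma forest_no_A (d : iname * seq tnode) : ~ @cint forest A_name (inr d).
Proof.
case: d => a [|t p] /= [_] // [gA|[s _ e]|[v _ e]].
- by case: gateP gA => ->.
- by have := node_name_range s; rewrite -e.
- by have := vis_name_range v; rewrite -e.
Qed.

Lemma child_realized a t p s s' : has_name t s -> child s s' ->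
  exists t', [/\ has_name t' s', tchild t t' & choice_ok a (t :: p) t'].
Proof.
move=> ts ss'.
have [t' [t's' ok main]] : exists t', [/\ has_name t' s', choice_ok a (t :: p) t' &
    if t' is ChoiceAt _ then s' = Choice M else True].
  exists (match s' with
    | Literal => GapAt us
    | AfterLiteral => GapAt [::]
    | Choice => ChoiceAt (choice a (t :: p))
    | _ => Plain s'
    end); case: s' ss' => //=; try by move=> _; split=> //; first [by left | by right].
  by case: s {ts} => // -[].
by exists t'; split=> //; left; exists s, s'.
Qed.

Inductive gap_node : tnode -> Prop :=
  | PlainGap : gap_node (Plain (Gap M))
  | ChoiceGap : gap_node (ChoiceAt false).

(** An element may have two names and so get edges from two sources; listing the possible edges by
    elements instead of names makes case analysis practicable. *)
Inductive tedge : tnode -> tnode -> Prop :=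
  | KindEdge k k' of kind_child k k' : tedge (Plain (Kind M k)) (Plain (Kind M k'))
  | StartEdge b : tedge (Plain (Start M)) (Plain (LeftPad M b))
  | LeftPadEdge : tedge (Plain (LeftPad M false)) (Plain (LeftGap M))
  | LeftGapEdge b : tedge (Plain (LeftGap M)) (Plain (LeftPad M b))
  | LiteralEdge : tedge (Plain (LeftPad M true)) (GapAt us)
  | DatumEdge x l : tedge (GapAt (x :: l)) (DatumAt x l)
  | GapEdge x l : tedge (DatumAt x l) (GapAt l)
  | RightPadEdge b : tedge (GapAt [::]) (Plain (RightPad M b))
  | RightGapEdge : tedge (Plain (RightPad M false)) (GapAt [::])
  | RowGapEdge : tedge (Plain (RightPad M true)) (Plain (RowGap M))
  | NewRowEdge z t of ainit z : tedge (Plain (RowGap M)) (Plain (NewLetter z t true))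
  | OldLetterEdge z t b s : tedge (Plain (NewLetter z t b)) (Plain (OldLetter z t s))
  | NewLetterEdge z t s z' t' of anext z s t z' :
      tedge (Plain (OldLetter z t s)) (Plain (NewLetter z' t' false))
  | ChoiceEdge z t s b of accepting z s t : tedge (Plain (OldLetter z t s)) (ChoiceAt b)
  | AnyLetterEdge t of gap_node t : tedge t (Plain (AnyLetter M))
  | AnyGapEdge : tedge (Plain (AnyLetter M)) (Plain (Gap M))
  | LateFinishEdge t of gap_node t : tedge t (Plain (LateFinish M)).

Variant has_name_spec : tnode -> node -> Prop :=
  | PlainName s of (match s with Literal | AfterLiteral | Datum _ | Choice => false | _ => true end) :
      has_name_spec (Plain s) s
  | DatumAtName x l : has_name_spec (DatumAt x l) (Datum M x)
  | LiteralName : has_name_spec (GapAt us) (Literal M)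
  | AfterLiteralName : has_name_spec (GapAt [::]) (AfterLiteral M)
  | ChoiceName b : has_name_spec (ChoiceAt b) (Choice M)
  | FinishName : has_name_spec (ChoiceAt true) (Finish M)
  | GapName : has_name_spec (ChoiceAt false) (Gap M).

Lemma has_nameP t s : has_name t s -> has_name_spec t s.
Proof.
case: t => [s'|x l|l|b] /=.
- by case: s' => // *; subst s; constructor.
- by move=> ->; constructor.
- by case=> -[-> ->]; constructor.
- by case=> ->; [constructor | case: b; constructor].
Qed.

Lemma tchild_tedge t t' : tchild t t' -> tedge t t'.
Proof.
case=> [[s [s' [/has_nameP ts ss' /has_nameP t's' main]]]|]; last first.
  by case: t t' => [?|x l|[|x l]|b] [?|y l'|l'|b'] //; [move=> -> | case=> -> ->]; constructor.
case: t's' main ss' => [{}s' p'|x' l'|||b'||] main ss' //;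
  case: ts ss' => [{}s p|x l|||b||] //.
all: try (case: s' {main} p' => //).
all: try (by move=> *; constructor; constructor).
all: try (case: s p => // *; constructor; constructor).
all: case: s p => //; repeat match goal with
  | |- forall b : bool, _ => case
  | |- is_true true -> _ => move=> _
  | |- forall x, _ => let h := fresh "h" in move=> h
  end; try done; try (by constructor).
all: repeat match goal with h : is_true (child _ _) |- _ => move: h => /= h; try done end.
1,2: by case/andP: h4 => /eqP <- /eqP <-; constructor.
all: by do 2 constructor.
Qed.

Lemma live_tedge a t t' p : live a [:: t, t' & p] -> live a (t' :: p) /\ tedge t' t.
Proof. by case=> lv /tchild_tedge. Qed.

Lemma forest_edge a t t' p : live a (t :: p) -> tchild t t' -> choice_ok a (t :: p) t' ->
  @rint forest R_role (inr (a, t :: p)) (inr (a, t' :: t :: p)) /\ live a (t' :: t :: p).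
Proof. by move=> lv tt' ok; split=> //; split=> //; split=> //; exists t'. Qed.

Lemma forest_graph P : tbox_sat forest (@graph_axioms M gate P).
Proof.
apply/graph_axioms_sat; split=> [s v d _ sv /forest_named[a [t [p [-> lv ts]]]]|].
  by split=> //; constructor 3; exists v => //; exists s.
move=> s s' d _ ss' /forest_named[a [t [p [-> lv ts]]]].
have [t' [t's' tt' ok]] := child_realized a p ts ss'.
have [edge lv'] := forest_edge lv tt' ok.
exists (inr (a, t' :: t :: p)) => //; apply/forest_named.
by exists a, t', (t :: p).
Qed.

Lemma forest_root t s a : root t -> has_name t s -> List.In (CAssert A_name a) ab ->
  exists2 e : dom forest, rint r (inl a : dom forest) e & named gate s e.
Proof.
move=> rt ts Aa; exists (inr (a, [:: t])); first by split=> //; exists t.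
by apply/forest_named; exists a, t, [::].
Qed.

Lemma forest_roots : tbox_sat forest (@root_axioms M gate r).
Proof.
apply/root_axioms_sat => k [a|d] ko; last by move/forest_no_A.
by apply: (@forest_root (Plain (Kind M k))) => //; left; exists k.
Qed.

Lemma forest_ban g : g = gate1 \/ g = gate2 -> g <> gate ->
  (forall a, ~ List.In (CAssert g a) ab) -> forall d : dom forest, ~ cint g d.
Proof.
move=> gP ng nab [a /nab //|[a [|t p]]] /= [_] // [/ng //|[s _ e]|[v _ e]].
- by have := node_name_range s; rewrite -e !inE; case: gP => ->.
- by have := vis_name_range v; rewrite -e !inE; case: gP => ->.
Qed.

Lemma forest_abox : abox_sat forest ab.
Proof. by move=> []. Qed.

End Forest.

(** * Forests as models of the two TBoxes *)

Section ForestModels.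
Variables (M : TM token) (r : rname) (ab : abox).

Lemma forest_horn_model us with_start choice :
  (forall a, ~ List.In (CAssert gate1 a) ab) ->
  (forall a, ~ List.In (CAssert gate2 a) ab) ->
  kb_model (@horn_tbox M r, ab) (@forest M us r ab gate1 with_start choice).
Proof.
move=> n1 n2; split; last exact: forest_abox.
apply/tbox_sat_cons; split.
  have n21 : gate2 <> gate1 by [].
  by move=> d /(forest_ban (or_intror erefl) n21 n2) [].
by apply/tbox_sat_cat; split; [apply: forest_roots | apply: forest_graph]; auto.
Qed.

Lemma forest_chain us choice a p l (F := @forest M us r ab gate2 true choice) :
  (forall a, ~ List.In (CAssert gate2 a) ab) ->
  live us ab true choice a (GapAt M l :: p) ->
  ceval (I := F) (chain (gated gate2 (AfterLiteral M)) l) (inr (a, GapAt M l :: p)).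
Proof.
move=> n2; have g2 : gate2 = gate1 \/ gate2 = gate2 by right.
have nm := @forest_named M us r ab gate2 true choice g2 n2.
elim: l p => [|x l IH] p lv.
  by apply: (nm (AfterLiteral M) (inr (a, _))).2; exists a, (GapAt M [::]), p; split=> //; right.
have ch1 : tchild us (GapAt M (x :: l)) (DatumAt M x l) by right.
have ch2 : tchild us (DatumAt M x l) (GapAt M l) by right.
have [e1 lv1] := @forest_edge M us r ab gate2 true choice _ _ _ _ lv ch1 I.
have [e2 lv2] := @forest_edge M us r ab gate2 true choice _ _ _ _ lv1 ch2 I.
have [g h] := (nm (Datum M x) (inr (a, DatumAt M x l :: GapAt M (x :: l) :: p))).2
  (ex_intro _ a (ex_intro _ _ (ex_intro _ _ (And3 erefl lv1 erefl)))).
exists (inr (a, DatumAt M x l :: GapAt M (x :: l) :: p)); split=> //.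
split=> //; split=> //.
by exists (inr (a, [:: GapAt M l, DatumAt M x l, GapAt M (x :: l) & p])); split=> //; apply: IH.
Qed.

Lemma forest_alc_model us choice :
  (forall a, ~ List.In (CAssert gate1 a) ab) ->
  (forall a, ~ List.In (CAssert gate2 a) ab) ->
  kb_model (@alc_tbox M r us, ab) (@forest M us r ab gate2 true choice).
Proof.
move=> n1 n2; have g2 : gate2 = gate1 \/ gate2 = gate2 by right.
have nm := @forest_named M us r ab gate2 true choice g2 n2.
split; last exact: forest_abox.
apply/tbox_sat_cons; split.
  move=> d /nm[a [t [p [-> lv ts]]]].
  have et : t = GapAt M us.
    case: t {lv} ts => [[] //|x l //|l|[] []//]; by case=> -[] // _ ->.
  by rewrite {}et {ts} in lv *; apply: forest_chain.
apply/tbox_sat_cons; split.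
  have n12 : gate1 <> gate2 by [].
  by move=> d /(forest_ban (or_introl erefl) n12 n1) [].
apply/tbox_sat_cons; split.
  move=> d /nm[a [t [p [-> lv ct]]]] /= [nf ng].
  have [b et] : exists b, t = ChoiceAt M b.
    by case: t ct {lv nf ng} => [s|x l|l|b] //; [case: s | case=> -[] | exists b].
  rewrite {}et in lv nf ng; case: b lv nf ng => lv nf ng; [apply: nf | apply: ng].
    by case: ((nm (Finish M) (inr (a, ChoiceAt M true :: p))).2
      (ex_intro _ a (ex_intro _ _ (ex_intro _ p (And3 erefl lv (or_intror erefl)))))).
  by case: ((nm (Gap M) (inr (a, ChoiceAt M false :: p))).2
    (ex_intro _ a (ex_intro _ _ (ex_intro _ p (And3 erefl lv (or_intror erefl)))))).
apply/tbox_sat_cons; split.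
  move=> [a Aa|d /forest_no_A []] //.
  have rs : root true (Plain (Start M)) by right.
  have [e ae ne] := @forest_root M us r ab gate2 true choice g2 n2 _ (Start M) a rs erefl Aa.
  by exists e.
by apply/tbox_sat_cat; split; [apply: forest_roots | apply: forest_graph]; auto.
Qed.

End ForestModels.

(** * Query fragments *)

Section Fragments.
Variables (M : TM token) (us : seq datum) (r : rname) (ab : abox) (bd : seq atom).

Notation letter := (letter M).

Definition edge (x y : var) : Prop := List.In (RAtom R_role x y) bd.
Definition label (v : vis M) (x : var) : Prop := List.In (CAtom (vis_name v) x) bd.

(* Identifications that hold in every forest model, because an anonymous element
   has at most one predecessor. *)
Inductive same : var -> var -> Prop :=
  | same_I x : label (VI M) x -> same x x
  | same_down x y : same x x -> edge x y -> same y y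
  | same_up z y y' x : same z z -> edge z y -> same y y' -> edge x y' -> same z x
  | same_sym x y : same x y -> same y x
  | same_trans x y z : same x y -> same y z -> same x z.

(* [forced w x]: below some I-variable there is a path to [x], up to forced
   identifications, whose variables at odd distances before [x] have the letters
   recorded in [w], the last one first. *)
Inductive forced : seq (option letter) -> var -> Prop :=
  | forced_I x : label (VI M) x -> forced [::] x
  | forced_same w x y : same x y -> forced w x -> forced w y
  | forced_even w x y : ~~ odd (size w) -> forced w x -> edge x y -> forced (None :: w) y
  | forced_odd w x x' y l : odd (size w) -> forced w x -> same x x' ->
      label (VL l) x' -> edge x y -> forced (Some l :: w) y.

Fixpoint alternating (w : seq (option letter)) : bool :=
  if w is o :: w' then (isSome o == odd (size w')) && alternating w' else true.

Lemma same_refl_l x y : same x y -> same x x.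
Proof. by move=> h; apply: same_trans h (same_sym h). Qed.

Lemma same_refl_r x y : same x y -> same y y.
Proof. by move=> h; apply: same_trans (same_sym h) h. Qed.

Lemma forced_below w x : forced w x -> same x x.
Proof.
elim=> {w x} [x|w x y xy _ _|w x y _ _ xx xy|w x x' y l _ _ xx _ _ xy].
- exact: same_I.
- exact: same_refl_r xy.
- exact: same_down xx xy.
- exact: same_down xx xy.
Qed.

Lemma forced_alternating w x : forced w x -> alternating w.
Proof.
elim=> {w x} //= [w x y /negPf -> _ -> //|w x x' y l -> _ -> //].
Qed.

Lemma forced_cons o w x : forced (o :: w) x -> exists y x',
  [/\ same x x', edge y x', forced w y &
    if o is Some l then odd (size w) /\ (exists2 y', same y y' & label (VL l) y')
    else ~~ odd (size w)].
Proof.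
move eq: (o :: w) => w0 h; elim: h o w eq => {w0 x} //.
- move=> w0 x y xy _ IH o w eq; have [z [x' [xx' zx' fz ow]]] := IH _ _ eq.
  by exists z, x'; split=> //; apply: same_trans (same_sym xy) xx'.
- move=> w0 x y ev fx _ xy o w [-> ->]; exists x, y; split=> //.
  exact: same_down (forced_below fx) xy.
- move=> w0 x x' y l od fx _ xx' lx' xy o w [-> ->]; exists x, y; split=> //.
    exact: same_down (forced_below fx) xy.
  by split=> //; exists x'.
Qed.

(** ** Soundness in forest models *)

(** The trace of [forced w] on the reversed path [p]: each entry of [w] speaks of the predecessor of
    the element at its place, and the I-element stands where [w] is exhausted. *)
Fixpoint fits (w : seq (option letter)) (p : seq (tnode M)) : Prop :=
  match w, p with
  | [::], t :: _ => tshows us t (VI M)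
  | o :: w', _ :: ((t :: _) as p') =>
      (if o is Some l then tshows us t (VL l) else True) /\ fits w' p'
  | _, _ => False
  end.

Section Soundness.
Variables (gate : cname) (with_start : bool).
Variable choice : iname -> seq (tnode M) -> bool.
Let F := forest us r ab gate with_start choice.
Hypothesis gateP : gate = gate1 \/ gate = gate2.
Variable f : var -> dom F.
Hypothesis f_sat : forall t, List.In t bd -> atom_sat f t.
Hypothesis I_anon : forall x, label (VI M) x -> exists p, f x = inr p.

Notation live := (live us ab with_start choice).

Lemma same_sound x y : same x y ->
  f x = f y /\ exists a p, f x = inr (a, p) /\ live a p.
Proof.
elim=> {x y}.
- move=> x Ix; split=> //; have [[a p] fx] := I_anon Ix.
  by exists a, p; split=> //; have := f_sat Ix; rewrite /= fx; case.
- move=> x y _ [_ [a [p [fx lv]]]] xy; split=> //.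
  have := f_sat xy; rewrite /= fx; case fy: (f y) => [b|[b p']] //=.
  by move=> [<- _ lv' _]; exists a, p'.
- move=> z y y' x _ [_ [a [p [fz lv]]]] zy _ [fyy' _] xy'.
  rewrite fz; suff -> : f x = inr (a, p) by split=> //; exists a, p.
  have := f_sat zy; have := f_sat xy'; rewrite /= -fyy' fz.
  case: (f y) => [b|[b p']] //=; case: (f x) => [b'|[b' p'']] /=.
    by move=> [_ _ _ [t ->]] [_ _ _ [p0 [t' [_ ep]]]]; case: p0.
  by move=> [-> _ _ [_ [t ->]]] [-> _ _ [_ [t' [_ ->]]]].
- by move=> x y _ [-> [a [p [e lv]]]]; split=> //; exists a, p.
- by move=> x y z _ [-> _] _ [-> h].
Qed.

Lemma forced_sound w x : forced w x ->
  exists a p, [/\ f x = inr (a, p), live a p & fits w p].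
Proof.
elim=> {w x}.
- move=> x Ix; have [_ [a [p [fx lv]]]] := same_sound (same_I Ix).
  exists a, p; split=> //; have : @cint F (vis_name (VI M)) (f x) := f_sat Ix.
  rewrite fx => /(forest_vis gateP).
  by move=> [_ [t [p' [-> ?]]]].
- move=> w x y /same_sound[-> _] _ [a [p h]]; by exists a, p.
- move=> w x y _ fx [a [p [ex lv ft]]] xy; have := f_sat xy; rewrite /= ex.
  case: (f y) => [b|[b p']] //= [<- _ lv' [p0 [t ep]]]; exists a, p'; split=> //.
  by rewrite ep; case: p ft p0 {ex lv ep}.
- move=> w x x' y l _ fx [a [p [ex lv ft]]] /same_sound[fxx' _] lx' xy.
  have : @cint F (vis_name (VL l)) (f x') := f_sat lx'.
  rewrite -fxx' ex => /(forest_vis gateP) [_ [t' [p1 [ep1 tl]]]].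
  have := f_sat xy; rewrite /= ex.
  case: (f y) => [b|[b p']] //= [<- _ lv' [p0 [t ep]]]; exists a, p'; split=> //.
  by rewrite ep ep1 in ft *.
Qed.

End Soundness.

(** ** Paths of kinds *)

Definition below x : Prop := same x x.

(** The most permissive kind for a match: a parity flag, which excludes [E_name], is set only if the
    query forces it. *)
Definition forced_kind (x : var) : kind :=
  (`[< exists2 w, forced w x & ~~ odd (size w) >],
   `[< exists2 w, forced w x & odd (size w) >],
   `[< exists y l, same x y /\ label (VL l) y >]).

Definition free_kind : kind := (false, false, true).

Definition below_parent (x y : var) : Prop :=
  below y /\ exists2 x', same x x' & edge y x'.

(** Where a variable matched at depth [n] of a grid tree is sent in the tree of kinds: forced kinds
    as far up as the query knows ancestors below an I-variable, free kinds above. Keeping the depth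
    makes edges go to edges. *)
Fixpoint kind_path (n : nat) (x : var) : seq kind :=
  if n is n'.+1 then
    if `[< below x >] then
      forced_kind x ::
      (if pselect (exists y, below_parent x y) is left h then kind_path n' (projT1 (cid h))
       else nseq n' free_kind)
    else nseq n free_kind
  else [::].

Lemma forced_kind_same x y : same x y -> forced_kind x = forced_kind y.
Proof.
move=> xy; rewrite /forced_kind; congr (_, _, _); apply: asbool_equiv_eq; split.
- by case=> w h o; exists w => //; apply: forced_same h.
- by case=> w h o; exists w => //; apply: forced_same h; apply: same_sym.
- by case=> w h o; exists w => //; apply: forced_same h.
- by case=> w h o; exists w => //; apply: forced_same h; apply: same_sym.
- by case=> z [l [xz lz]]; exists z, l; split=> //; apply: same_trans (same_sym xy) xz.
- by case=> z [l [xz lz]]; exists z, l; split=> //; apply: same_trans xy xz.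
Qed.

Lemma below_parents x y y' : below_parent x y -> below_parent x y' -> same y y'.
Proof.
move=> [by_ [x1 xx1 yx1]] [by' [x2 xx2 yx2]].
exact: same_up by_ yx1 (same_trans (same_sym xx1) xx2) yx2.
Qed.

Lemma kind_path_same n x y : same x y -> kind_path n x = kind_path n y.
Proof.
elim: n x y => //= n IH x y xy.
rewrite !asboolT ?(forced_kind_same xy); [|exact: same_refl_r xy|exact: same_refl_l xy].
congr (_ :: _).
have bp z : below_parent x z <-> below_parent y z.
  split=> -[bz [x1 xx1 zx1]]; split=> //; exists x1 => //.
    exact: same_trans (same_sym xy) xx1.
  exact: same_trans xy xx1.
case: pselect => [h|h]; case: pselect => [h'|h'] //.
- apply: IH; case: (cid h) => z /= hz; case: (cid h') => z' /= hz'.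
  by apply: (@below_parents y) => //; apply/bp.
- by case: h'; case: h => z /bp hz; exists z.
- by case: h; case: h' => z /bp hz; exists z.
Qed.

Lemma kind_path_parent n x y : below x -> below_parent x y ->
  kind_path n.+1 x = forced_kind x :: kind_path n y.
Proof.
move=> bx bp /=; rewrite asboolT //; congr (_ :: _).
case: pselect => [h|[]]; last by exists y.
by apply: kind_path_same; case: (cid h) => z /= hz; apply: below_parents hz bp.
Qed.

Lemma kind_path_free n x : ~ below x -> kind_path n x = nseq n free_kind.
Proof. by case: n => //= n h; rewrite asboolF. Qed.

Lemma kind_path_edge n x y : edge y x -> exists k, kind_path n.+1 x = k :: kind_path n y.
Proof.
move=> yx; have [bx|nbx] := pselect (below x); last first.
  have nby : ~ below y by move=> b; apply: nbx; apply: same_down b yx.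
  by exists free_kind; rewrite !kind_path_free.
exists (forced_kind x); have [by_|nby] := pselect (below y).
  by apply: kind_path_parent => //; split=> //; exists x.
rewrite [in RHS]kind_path_free //= asboolT //; congr (_ :: _).
(* Any known parent of [x] would be identified with [y], its predecessor by an edge, and [y] would
   be below an I-variable after all. *)
case: pselect => // -[z [bz [x' xx' zx']]]; case: nby.
exact: same_refl_r (same_up bz zx' (same_sym xx') yx).
Qed.

Definition kind_edge (p : seq kind) (k : kind) : bool :=
  if p is k0 :: _ then kind_child k0 k else ~~ kind_odd k.

Fixpoint kind_live (p : seq kind) : bool :=
  if p is k :: p' then kind_edge p' k && kind_live p' else true.

Lemma kind_live_free n : kind_live (nseq n free_kind).
Proof. by elim: n => // -[|n] IH. Qed.

Lemma forced_kind_child x y : below_parent x y ->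
  kind_child (forced_kind y) (forced_kind x).
Proof.
move=> bp; have [by_ [x' xx' yx']] := bp; apply/andP; split.
  apply/eqP; rewrite /kind_odd /kind_even /=; apply: asbool_equiv_eq; split.
    case=> -[|o w] // /forced_cons [y' [x1 [xx1 yx1 fy' _]]] ow.
    exists w; last exact: ow.
    have bp' : below_parent x y' by split; [exact: forced_below fy' | exists x1].
    exact: forced_same (below_parents bp' bp) fy'.
  case=> w fy ev; exists (None :: w) => //.
  by apply: forced_same (same_sym xx') _; apply: forced_even yx'.
rewrite /kind_odd /kind_even /kind_letter /=; apply/implyP => /andP[].
move=> /asboolP[w fy od] /asboolP[y' [l [yy' ly']]]; apply/asboolP.
exists (Some l :: w); last by rewrite /= negbK.
exact: forced_same (same_sym xx') (forced_odd od fy yy' ly' yx').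
Qed.

Section KindPathLive.
Variables (gate : cname) (with_start : bool).
Variable choice : iname -> seq (tnode M) -> bool.
Let F := forest us r ab gate with_start choice.
Hypothesis gateP : gate = gate1 \/ gate = gate2.
Variable f : var -> dom F.
Hypothesis f_sat : forall t, List.In t bd -> atom_sat f t.
Hypothesis I_anon : forall x, label (VI M) x -> exists p, f x = inr p.

(** The critical point is the root, where the odd flag must be false. A forced odd flag comes from a
    parent in the query, and the match [f] puts this parent above [x], so [x] is not at a root. *)
Lemma kind_path_live a p x : f x = inr (a, p) -> kind_live (kind_path (size p) x).
Proof.
elim: p x => //= t p IH x fx; case: asboolP => [bx|_]; last exact: (kind_live_free (size p).+1).
have no_odd : ~ (exists y, below_parent x y) -> kind_odd (forced_kind x) = false.
  move=> np; apply/asboolP => -[[|o w] //] /forced_cons[y [x' [xx' yx' fy _]]] _.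
  by apply: np; exists y; split; [exact: forced_below fy | exists x'].
case: pselect => [h|/no_odd no]; last first.
  rewrite /= kind_live_free andbT; case: (p) => [|t' p'] /=; first by rewrite no.
  by rewrite /kind_child no.
have [y bp] := h; have [by_ [x' xx' yx']] := bp.
rewrite (_ : kind_path (size p) _ = kind_path (size p) y); last first.
  by apply: kind_path_same; case: (cid h) => z /= hz; apply: below_parents hz bp.
have [fyy [a' [p' [fy lv]]]] := same_sound f_sat I_anon by_.
have [fxx' _] := same_sound f_sat I_anon xx'.
have := f_sat yx'; rewrite /= -fxx' fx fy => -[ea _ _ [p0 [t' [_ ep]]]].
rewrite -{}ep ea in fy p0 lv *; rewrite /= IH // andbT.
case: p p0 {lv fx IH fy} => //= t1 p1 _; rewrite asboolT //.
exact: forced_kind_child.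
Qed.

End KindPathLive.

Lemma kind_path_shows n v x : (forall w y, forced w y -> ~ label (VE M) y) ->
  label v x -> exists k p, kind_path n.+1 x = k :: p /\ kind_shows k v.
Proof.
move=> noE vx; rewrite /=; case: asboolP => [bx|nbx].
  exists (forced_kind x); eexists; split; first by [].
  case: v vx => [||l] vx /=; rewrite /kind_even /kind_odd /kind_letter /=.
  - by apply/asboolP; exists [::] => //; apply: forced_I.
  - by apply/andP; split; apply/asboolP => -[w /noE].
  - by apply/asboolP; exists x, l.
exists free_kind; eexists; split; first by [].
by case: v vx => // Ix; case: nbx; apply: same_I.
Qed.

End Fragments.

(** * Paths of the grid tree *)

Section Paths.
Variables (M : TM token) (us : seq datum) (ab : abox).
Variable choice : iname -> seq (tnode M) -> bool.

Notation letter := (letter M).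
Notation tnode := (tnode M).
Notation live := (live us ab true choice).

Definition not_kind (t : tnode) : bool := if t is Plain (Kind _) then false else true.

(** Stages of a branch: the start, the initial row, the first letter of the next row, the remaining
    rows, and everything from the disjunction on. *)
Definition phase (t : tnode) : nat :=
  match t with
  | Plain s =>
    match s with
    | Start => 0
    | LeftPad _ | LeftGap | RightPad _ | RowGap => 1
    | NewLetter _ _ b => if b then 2 else 3
    | OldLetter _ _ _ => 3
    | _ => 4
    end
  | DatumAt _ _ | GapAt _ => 1
  | ChoiceAt _ => 4
  end.

Definition parity (t : tnode) : bool :=
  match t with
  | Plain s =>
    match s with LeftPad _ | RightPad _ | NewLetter _ _ _ | Gap => true | _ => false end
  | DatumAt _ _ | ChoiceAt _ => true
  | GapAt _ => false
  end.

Definition new_letter (t : tnode) : option letter :=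
  match t with
  | Plain (LeftPad b) => Some (left_pad M b)
  | Plain (RightPad b) => Some (right_pad M b)
  | Plain (NewLetter _ t _) => Some t
  | DatumAt x _ => Some (datum_letter M x)
  | _ => None
  end.

Definition old_letter (t : tnode) : option letter :=
  if t is Plain (OldLetter _ _ s) then Some s else None.

(** By the last clause a branch is in phase 2 at most once. As I-elements of the grid are either the
    start or in phase 2, a branch has at most two of them. *)
Lemma tedge_phase t t' : tedge us t t' -> not_kind t' ->
  [/\ not_kind t, parity t' = ~~ parity t, phase t <= phase t', 0 < phase t' &
    1 < phase t -> 2 < phase t'].
Proof. by case=> //= [_ _ [] _ _|_ []|_ []]. Qed.

Lemma live_not_kind a t p : live a (t :: p) -> not_kind t ->
  all not_kind p /\ parity t = odd (size p).
Proof.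
elim: p t => [|t' p IH] t; first by move=> [_ [[k _ ->]|[_ ->]]].
move=> /live_tedge[lv e] nt; have [nt' -> _ _ _] := tedge_phase e nt.
by have [/= -> ->] := IH _ lv nt'; rewrite nt'.
Qed.

Lemma live_drop a n p t q : live a p -> drop n p = t :: q -> live a (t :: q).
Proof.
elim: n p => [|n IH] [|t1 p] //=; first by move=> lv [<- <-].
by case: p => [|t2 p] // /live_tedge[lv _]; apply: IH.
Qed.

Lemma live_phase a t1 p1 t p : live a (t1 :: p1 ++ t :: p) -> not_kind t1 ->
  [/\ phase t <= phase t1, 0 < phase t1 & 1 < phase t -> 2 < phase t1].
Proof.
elim: p1 t1 => [|t2 p1 IH] t1 /= /live_tedge[lv e] nt;
  have [nt2 _ le12 gt0 gt2] := tedge_phase e nt => //.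
have [le2 gt20 gt22] := IH _ lv nt2; split=> //; first exact: leq_trans le12.
by move=> /gt22 h; apply: leq_trans le12.
Qed.

Lemma tshows_letter t l : phase t <= 3 -> tshows us t (VL l) ->
  if parity t then new_letter t = Some l else old_letter t = Some l.
Proof.
move=> ph [s /has_nameP ts sl]; case: ts sl ph => //= [{}s|x _ /eqP[<-]] //.
case: s => //= [b _ /eqP[<-]|b _ /eqP[<-]|z t0 b _ /orP[/eqP[<-]|/andP[_ /eqP]]|z t0 s _ /eqP[<-]] //.
Qed.

Lemma tshows_I t : not_kind t -> tshows us t (VI M) ->
  t = Plain (Start M) \/ phase t = 2.
Proof.
move=> nt [s /has_nameP ts sI]; case: ts sI nt => //= {}s.
by case: s => //= [_ _|z t0 [] //= _]; [left | right].
Qed.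

Lemma live_start a p : live a (Plain (Start M) :: p) -> p = [::].
Proof. by case: p => // t p /live_tedge[_ /tedge_phase[]]. Qed.

Lemma fits_drop w p : fits us w p ->
  exists t q, drop (size w) p = t :: q /\ tshows us t (VI M).
Proof.
elim: w p => [|o w IH] [|t p] //=; first by move=> h; exists t, p.
by case: p => // t' p [_ /IH].
Qed.

Lemma old_letters_early a t p : live a (t :: p) -> not_kind t -> phase t <= 2 ->
  pmap old_letter (t :: p) = [::].
Proof.
elim: p t => [|t' p IH] t.
  by case: t => // -[] // ? ? ? _ _.
move=> /live_tedge[lv e] nt ph; have [nt' _ le _ _] := tedge_phase e nt.
rewrite [pmap _ _]/= -/(pmap old_letter (t' :: p)) IH // ?(leq_trans le) //.
by case: t ph {e nt le} => // -[].
Qed.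

(** New letters stand at odd distances from the start, where [w] records its letters. The end [t] is
    not assumed live: it will be the disjunct that the model does not choose. *)
Lemma fits_from_start w a t p : fits us w (t :: p) -> alternating w ->
  (if p is t' :: _ then [/\ live a p, not_kind t' & phase t' <= 3] else True) ->
  drop (size w) (t :: p) = [:: Plain (Start M)] -> pmap id w = pmap new_letter p.
Proof.
elim: w t p => [|o w IH] t [|t' p] //=.
move=> [ot ft] /andP[/eqP ow alt] [lv nt' ph] dr; have := IH _ _ ft alt _ dr.
have -> : o = new_letter t'.
  have [_ par] := live_not_kind lv nt'.
  have sz : size p = size w.
    by have := congr1 size dr; rewrite size_drop /=; lia.
  rewrite sz -ow in par; case: o ot par {ow} => [l|] /=.
    by move=> /(tshows_letter ph) + par; rewrite par => ->.
  by move=> _; case: t' {lv nt' ph ft dr} => // -[].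
move=> -> //; case: p lv {ft dr} => // t2 p /live_tedge[lv e].
have [nt2 _ le _ _] := tedge_phase e nt'.
by split=> //; apply: leq_trans le ph.
Qed.

(** The element [u] is at an odd distance from the start, so odd distances from [u] are even ones
    from the start, where the old letters stand. [e] collects the letters read after the
    disjunction. *)
Lemma fits_from_row w a t p u q : fits us w (t :: p) -> alternating w ->
  live a (t :: p) -> not_kind t -> drop (size w) (t :: p) = u :: q -> phase u = 2 ->
  exists e, pmap id w = e ++ pmap old_letter p /\ (phase t <= 3 -> e = [::]).
Proof.
elim: w t p => [|o w IH] t p.
  move=> _ _ lv nt; rewrite drop0 => -[<- _] ph; exists [::]; split=> //=.
  have := old_letters_early lv nt; rewrite ph => /(_ isT) /=.
  by case: old_letter.
case: p => [|t' p] //= [ot ft] /andP[/eqP ow alt] /live_tedge[lv te] nt dr ph.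
have [nt' _ le _ _] := tedge_phase te nt.
have [e [-> e0]] := IH _ _ ft alt lv nt' dr ph.
have par : parity t' = ~~ odd (size w).
  have [_ ->] := live_not_kind lv nt'.
  have lvu := live_drop lv dr; have nu : not_kind u.
    have [np _] := live_not_kind lv nt'.
    have : all not_kind (t' :: p) by rewrite /= nt'.
    by rewrite -(cat_take_drop (size w) (t' :: p)) dr all_cat => /andP[_ /andP[]].
  have [_] := live_not_kind lvu nu.
  have -> : parity u by case: (u) ph => // -[].
  by have := congr1 size dr; rewrite size_drop /= => sz oq;
    rewrite (_ : size p = size w + size q) ?oddD -?oq ?addbT //; lia.
case: o ot ow => [l|] ot ow; rewrite -ow /= in par.
  have [ph3|ph4] := leqP (phase t') 3.
    have := tshows_letter ph3 ot; rewrite par => ->; rewrite e0 //=.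
    by exists [::].
  exists (l :: e); rewrite (_ : old_letter t' = None).
    by split=> // ph3; have := leq_trans le ph3; rewrite leqNgt ph4.
  by case: t' ph4 {lv te nt nt' dr ft ot par e0 le} => // -[].
exists e; rewrite (_ : old_letter t' = None).
  by split=> // ph3; apply: e0; apply: leq_trans ph3.
by case: t' par {lv te nt nt' dr ft ot e0 le ow} => // -[].
Qed.

(** ** Reading the rows off a path *)

Lemma rev_pmap_cons (T : Type) (f : tnode -> option T) t p :
  rev (pmap f (t :: p)) = if f t is Some x then rcons (rev (pmap f p)) x else rev (pmap f p).
Proof. by rewrite /=; case: (f t) => //= x; rewrite rev_cons. Qed.

(** Phrased with a continuation because [run] recurses from the front while a branch grows at its
    end. *)
Definition runs_to (z : astate M) (ts ss : seq letter) : Prop :=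
  forall ps, run z ps -> exists2 z0, ainit z0 & run z0 (zip ss ts ++ ps).

Definition row_prefix (k k' : nat) (xs : seq datum) : seq letter :=
  nseq k (left_pad M false) ++ left_pad M true :: map (datum_letter M) xs ++
  nseq k' (right_pad M false).

(** Invariant along a branch: which words of new and old letters can have been spelled on the way to
    [t]. *)
Definition reads (t : tnode) (new old : seq letter) : Prop :=
  match t with
  | Plain s =>
    match s with
    | Start => new = [::]
    | LeftPad b => exists k, new = rcons (nseq k (left_pad M false)) (left_pad M b)
    | LeftGap => exists k, new = nseq k (left_pad M false)
    | RightPad b => exists k k', new = rcons (row_prefix k k' us) (right_pad M b)
    | RowGap => exists k k', new = initial_row M us k k'
    | NewLetter z t b => exists k k' ts ss, [/\ new = initial_row M us k k' ++ rcons ts t,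
        old = ss, size ts = size ss & runs_to z ts ss]
    | OldLetter z t s => exists k k' ts ss, [/\ new = initial_row M us k k' ++ rcons ts t,
        old = rcons ss s, size ts = size ss & runs_to z ts ss]
    | _ => True
    end
  | GapAt l => exists k k' xs, [/\ us = xs ++ l, l <> [::] -> k' = 0 & new = row_prefix k k' xs]
  | DatumAt x l => exists k xs, us = xs ++ x :: l /\ new = row_prefix k 0 (rcons xs x)
  | ChoiceAt _ => True
  end.

Lemma initial_row_prefix k k' :
  initial_row M us k k' = rcons (row_prefix k k' us) (right_pad M true).
Proof. by rewrite /initial_row /row_prefix rcons_cat /= rcons_cat. Qed.

Lemma reads_rev a t p : live a (t :: p) -> not_kind t ->
  reads t (rev (pmap new_letter (t :: p))) (rev (pmap old_letter (t :: p))).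
Proof.
elim: p t => [|t' p IH] t; first by move=> [_ [[k _ ->]|[_ ->]]].
move=> lvt nt; have [lv e] := live_tedge lvt; have [nt' _ le _ _] := tedge_phase e nt.
have := IH _ lv nt'; rewrite [in X in _ -> X]rev_pmap_cons [in X in _ -> X](rev_pmap_cons _ t).
have early : phase t' <= 2 -> rev (pmap old_letter (t' :: p)) = [::].
  by move=> ph; rewrite (old_letters_early lv).
move: (rev _) (rev _) early => new old early.
case: {lv lvt nt' le IH} e nt early => //=.
- by move=> b _ _ ->; exists 0.
- by move=> _ _ [k ->]; exists k.+1; rewrite rcons_nseq.
- by move=> b _ _ [k ->]; exists k.
- by move=> _ _ [k ->]; exists k, 0, [::]; rewrite /row_prefix /= -cats1.
- move=> x l _ _ [k [k' [xs [-> k0 ->]]]]; exists k, xs; rewrite k0 //; split=> //.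
  by rewrite /row_prefix !cats0 map_rcons rcons_cat.
- move=> x l _ _ [k [xs [-> ->]]]; exists k, 0, (rcons xs x); split=> //.
  by rewrite cat_rcons.
- move=> b _ _ [k [k' [xs [eus _ ->]]]]; exists k, k'.
  by rewrite cats0 in eus; rewrite eus.
- move=> _ _ [k [k' ->]]; exists k, k'.+1, us; split=> //; first by rewrite cats0.
  by rewrite /row_prefix rcons_cat /= rcons_cat rcons_nseq.
- by move=> _ _ [k [k' ->]]; exists k, k'; rewrite initial_row_prefix.
- move=> z t0 zi _ early [k [k' ->]]; exists k, k', [::], [::]; split=> //.
  + by rewrite cats1.
  + exact: early.
  + by move=> ps rn; exists z.
- move=> z t0 b s _ _ [k [k' [ts [ss [-> -> sz rt]]]]].
  by exists k, k', ts, ss.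
- move=> z t0 s z' t1 nx _ _ [k [k' [ts [ss [-> -> sz rt]]]]].
  exists k, k', (rcons ts t0), (rcons ss s); split=> //.
  + by rewrite rcons_cat.
  + by rewrite !size_rcons sz.
  + move=> ps rn; have [|z0 zi rn0] := rt ((s, t0) :: ps).
      by rewrite run_cons; [exists z' | case: ps rn].
    by exists z0 => //; rewrite zip_rcons // cat_rcons.
Qed.

Lemma late_path a t p : live a (t :: p) -> not_kind t -> phase t = 4 ->
  ~ (exists b, t = ChoiceAt M b) ->
  exists ys p', [/\ p = ys ++ ChoiceAt M false :: p', all not_kind ys,
    pmap old_letter ys = [::] & live a (ChoiceAt M false :: p')].
Proof.
elim: p t => [|t' p IH] t lvt nt ph nc.
  by case: lvt nt ph => _ [[k _ ->]|[_ ->]].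
have [lv e] := live_tedge lvt.
have gap u : gap_node u -> u = t' -> exists ys p', [/\ t' :: p = ys ++ ChoiceAt M false :: p',
    all not_kind ys, pmap old_letter ys = [::] & live a (ChoiceAt M false :: p')].
  move=> gu eu; case: gu eu => eu; rewrite -eu in lv *; last by exists [::], p.
  have [|||ys [p' [-> nk ol lv']]] := IH _ lv => //; first by case.
  by exists (Plain (Gap M) :: ys), p'.
case: e nt ph nc lv gap => //= [z t0 s b _ _ _ nc|u gu _ _ _ _|_ _ _ lv _|u gu _ _ _ _].
- by case: nc; exists b.
- by move/(_ _ gu erefl).
- have [|||ys [p' [-> nk ol lv']]] := IH _ lv => //; first by case.
  by exists (Plain (AnyLetter M) :: ys), p'.
- by move/(_ _ gu erefl).
Qed.

(** A branch that passes the disjunction by [Gap] does so because [w] would have fitted at [Finish].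
    So [w] fits twice along one branch, and the fit at the late end begins strictly lower. Only two
    I-elements are available: the early fit begins at the start and reads the new letters, the late
    one in phase 2 and reads the old letters and then [e]. Equating the two readings gives the
    stream. *)
Lemma late_finish_stream w a p :
  (forall a p, choice a p = ~~ `[< fits us w (ChoiceAt M true :: p) >]) ->
  alternating w -> live a (Plain (LateFinish M) :: p) ->
  fits us w (Plain (LateFinish M) :: p) ->
  exists k k' ts ss, stream us k k' ts (ss : seq letter).
Proof.
move=> choiceP alt lv ft.
have [|||ys [p' [ep nys oys lvc]]] := late_path lv => //; first by case.
have := lvc; case: p' lvc ep => [|t0 p'] lvc ep; first by case=> _ [[k _ //]|[_ //]].
move=> [_ _]; have [lv0 e] := live_tedge lvc; rewrite /choice_ok choiceP => /esym/negbFE/asboolP ft1.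
have [z [t [s [et0 az]]]] : exists z t s, t0 = Plain (OldLetter z t s) /\ accepting z s t.
  move eqc : (ChoiceAt M false) e => c e; case: e eqc {lvc ft1 lv0 ep} => // z t s b az _.
  by exists z, t, s.
have nt0 : not_kind t0 by rewrite et0.
have [t1 [q1 [dr1 I1]]] := fits_drop ft1.
have [t2 [q2 [dr2 I2]]] := fits_drop ft.
have npP : all not_kind (Plain (LateFinish M) :: p).
  by have [h _] := live_not_kind lv isT; rewrite /= h.
have lv2 := live_drop lv dr2.
have w1 : 0 < size w.
  case: (w) dr1 I1 => //= -[<- _].
  by move/tshows_I => /(_ isT) [].
have dr1' : drop (size w).-1 (t0 :: p') = t1 :: q1 by case: (size w) w1 dr1.
have lv1 := live_drop lv0 dr1'.
have suffix : drop (size ys).+1 (t2 :: q2) = t1 :: q1.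
  rewrite -dr2 drop_drop ep addSn /= addnC -drop_drop drop_size_cat //.
  by rewrite -dr1'; case: (size w) w1.
have n2 : not_kind t2.
  by move: npP; rewrite -(cat_take_drop (size w) (_ :: p)) dr2 all_cat => /andP[_ /andP[]].
have eq2 : q2 = take (size ys) q2 ++ t1 :: q1.
  by rewrite -suffix /= cat_take_drop.
have n1 : not_kind t1.
  by have [h _] := live_not_kind lv2 n2; move: h; rewrite eq2 all_cat => /andP[_ /andP[]].
have ph21 := lv2; rewrite eq2 in ph21; have [_ ph2 ph12] := live_phase ph21 n2.
have ph2' : phase t2 = 2 by case: (tshows_I n2 I2) ph2 => [->|].
have et1 : t1 = Plain (Start M).
  by case: (tshows_I n1 I1) => // ph1; move: ph12; rewrite ph1 ph2' => /(_ isT).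
rewrite {}et1 in dr1 lv1; have eq1 := live_start lv1; rewrite {}eq1 in dr1.
have W1 : pmap id w = pmap new_letter (t0 :: p').
  by apply: (@fits_from_start w a _ _ ft1 alt _ dr1); split=> //; rewrite et0.
have [e0 [W2 _]] := fits_from_row ft alt lv isT dr2 ph2'.
have := reads_rev lv0 nt0; rewrite {1}et0 => -[k [k' [ts [ss [new old sz rt]]]]].
have [|z0 zi rn] := rt [:: (s, t)]; first exact: az.
exists k, k', (rcons ts t), (rcons ss s), (rev e0), z0; split=> //.
- by rewrite zip_rcons // -cats1.
- by rewrite !size_rcons sz.
- rewrite -new -old -rev_cat -W1 W2 ep pmap_cat oys /=.
  by [].
Qed.

End Paths.

(** * Transferring matches to models of the Horn TBox *)

Section Transfer.
Variables (M : TM token) (us : seq datum) (r : rname) (ab : abox).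

Lemma live_A with_start (choice : iname -> seq (tnode M) -> bool) a p :
  live us ab with_start choice a p ->
  List.In (CAssert A_name a) ab.
Proof.
elim: p => [|t p IH] //; case: p IH => [|t' p] IH; first by case.
by case=> /IH.
Qed.

Definition in_tree (d : iname + iname * seq (tnode M)) : bool :=
  if d is inr (_, t :: _) then not_kind t else false.

Definition node_kind (t : tnode M) : kind :=
  if t is Plain (Kind k) then k else (false, false, false).

Lemma live_kinds with_start (choice : iname -> seq (tnode M) -> bool) a t p :
  live us ab with_start choice a (t :: p) -> ~~ not_kind t ->
  [/\ t = Plain (Kind M (node_kind t)), kind_live (map node_kind (t :: p)) &
    if p is t' :: _ then ~~ not_kind t' else true].
Proof.
elim: p t => [|t' p IH] t.
  by move=> [_ [[k ko ->]|[_ ->]]] //= _; split=> //; rewrite ko.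
move=> [lv /tchild_tedge e _] nt.
have [k [k' [et et' kk']]] : exists k k',
    [/\ t' = Plain (Kind M k), t = Plain (Kind M k') & kind_child k k'].
  by case: e nt => // k k' kk' _; exists k, k'.
have [|_ kl _] := IH t' lv; first by rewrite et.
by rewrite et et' /= in kl *; rewrite kk' kl.
Qed.

Variable I : interp.
Hypothesis I_model : kb_model (@horn_tbox M r, ab) I.

(** The default [inl a] does not occur on live paths below an individual that the ABox asserts to be
    in [A_name]. *)
Fixpoint embed (a : iname) (p : seq kind) : dom I :=
  if p is k :: p' then
    if pselect (exists e, @rint I (if p' is [::] then r else R_role) (embed a p') e /\
        named gate1 (Kind M k) e) is left h then projT1 (cid h) else inl a
  else inl a.

Lemma horn_tboxP : [/\ forall k (a : dom I), ~~ kind_odd k -> cint A_name a ->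
    exists2 e, rint r a e & named gate1 (Kind M k) e,
  forall k v (d : dom I), kind_shows k v -> named gate1 (Kind M k) d ->
    cint (vis_name (v : vis M)) d &
  forall k k' (d : dom I), kind_child k k' -> named gate1 (Kind M k) d ->
    exists2 e, rint R_role d e & named gate1 (Kind M k') e].
Proof.
case: I_model => /tbox_sat_cons[_ /tbox_sat_cat[/root_axioms_sat h /graph_axioms_sat[h1 h2]]] _.
split=> // [k v d|k k' d]; first exact: (h1 (Kind M k) v d isT).
exact: (h2 (Kind M k) (Kind M k') d isT).
Qed.

Lemma embed_edge a k p : List.In (CAssert A_name a) ab -> kind_live (k :: p) ->
  @rint I (if p is [::] then r else R_role) (embed a p) (embed a (k :: p)) /\
  named gate1 (Kind M k) (embed a (k :: p)).
Proof.
move=> Aa; have [h1 _ h3] := horn_tboxP.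
have Ia : @cint I A_name (inl a) by case: I_model => _ /(_ _ Aa).
suff ex : kind_live (k :: p) -> exists e,
    @rint I (if p is [::] then r else R_role) (embed a p) e /\ named gate1 (Kind M k) e.
  by move=> /ex h /=; case: pselect => // h'; case: (cid h').
elim: p k => [|k' p IH] k /andP[ke kl].
  by have [e ae ne] := h1 k _ ke Ia; exists e.
have [_ nm] : @rint I (if p is [::] then r else R_role) (embed a p) (embed a (k' :: p)) /\
    named gate1 (Kind M k') (embed a (k' :: p)).
  by have h := IH _ kl; rewrite /=; case: pselect => // h'; case: (cid h').
by have [e ae ne] := h3 _ _ _ ke nm; exists e.
Qed.

Definition embed_elt (d : iname + iname * seq (tnode M)) : dom I :=
  match d with inl a => inl a | inr (a, p) => embed a (map node_kind p) end.

Section EmbedForest.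
Variables (gate : cname) (with_start : bool) (choice : iname -> seq (tnode M) -> bool).
Hypothesis gateP : gate = gate1 \/ gate = gate2.
Let F := forest us r ab gate with_start choice.

Lemma embed_elt_A (d : dom F) : cint A_name d -> cint A_name (embed_elt d).
Proof.
case: d => [a|d]; last by move/(forest_no_A gateP).
by case: I_model => _ sat /sat.
Qed.

Lemma embed_elt_vis v (d : dom F) : ~~ in_tree d ->
  cint (vis_name (v : vis M)) d -> cint (vis_name v) (embed_elt d).
Proof.
case: d => [a|[a p]]; first by case: I_model => _ sat _ /sat.
move=> nt /(forest_vis gateP) [lv [t [p' [ep tv]]]]; rewrite {p}ep in lv nt *.
have [et kl _] := live_kinds lv nt.
have [_ nm] := embed_edge (live_A lv) kl.
have [_ h2 _] := horn_tboxP; apply: h2 nm.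
by move: tv; rewrite et => -[s /has_nameP ts]; inversion ts; subst.
Qed.

Lemma embed_elt_edge (d e : dom F) : ~~ in_tree d -> ~~ in_tree e ->
  rint R_role d e -> rint R_role (embed_elt d) (embed_elt e).
Proof.
case: d e => [a|[a p]] [b|[b p']] // nd ne.
- by case: I_model => _ sat /sat.
- move=> /= [<- er lv [t ep]]; rewrite {}ep in lv ne *.
  have [et kl _] := live_kinds lv ne.
  by have [+ _] := embed_edge (live_A lv) kl; rewrite -er.
- move=> /= [<- _ lv [p0 [t ep]]]; rewrite {}ep in lv ne *.
  have [et kl _] := live_kinds lv ne.
  by have [+ _] := embed_edge (live_A lv) kl; case: (p) p0.
Qed.

End EmbedForest.

Variable bd : seq atom.
Hypothesis bd_sig : forall t, List.In t bd ->
  match t with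
  | CAtom B _ => B = A_name \/ exists v, B = vis_name (v : vis M)
  | RAtom R _ _ => R = R_role
  end.
Hypothesis no_gate1 : forall a, ~ List.In (CAssert gate1 a) ab.
Hypothesis no_gate2 : forall a, ~ List.In (CAssert gate2 a) ab.

Let grid choice := @forest M us r ab gate2 true choice.

Definition matches (J : interp) (cs : seq (var * iname)) (h : var -> dom J) : Prop :=
  (forall t, List.In t bd -> atom_sat h t) /\
  (forall c, List.In c cs -> h c.1 = inl c.2).

Lemma transfer_outside choice cs (f : var -> dom (grid choice)) : matches cs f ->
  (forall t x, List.In t bd -> x \in atom_vars t -> ~~ in_tree (f x)) ->
  exists h : var -> dom I, matches cs h.
Proof.
move=> [fs fc] out; exists (fun x => embed_elt (f x)); split; last first.
  by move=> c /fc ->.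
have g2 : gate2 = gate1 \/ gate2 = gate2 by right.
move=> t tb; have := fs _ tb; have := out _ _ tb; have := bd_sig tb.
case: t {tb} => [B x|R x y] /=.
  case=> [->|[v ->]] nt; first exact: (embed_elt_A (choice := choice) g2).
  by apply: (embed_elt_vis (choice := choice) g2); apply: nt; rewrite mem_head.
move=> -> nt; apply: (embed_elt_edge (choice := choice)); apply: nt; rewrite !inE eqxx ?orbT //.
Qed.

Lemma edge_into_tree choice (d e : dom (grid choice)) : rint R_role d e -> in_tree e ->
  (exists a p t, [/\ d = inr (a, p), e = inr (a, t :: p), in_tree d &
     live us ab true choice a (t :: p)]) \/
  (exists a t, [/\ d = inl a, e = inr (a, [:: t]), r = R_role &
     live us ab true choice a [:: t]]).
Proof.
case: d e => [a|[a p]] [b|[b p']] //=.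
  by move=> [<- er lv [t ep]]; rewrite ep in lv *; right; exists a, t.
move=> [<- _ lv [p0 [t ep]]]; rewrite {}ep in lv *; move=> nt; left.
exists a, p, t; split=> //.
by case: p lv p0 => // t' p /live_tedge[_ /tedge_phase[]].
Qed.

Lemma edge_from_tree choice (d e : dom (grid choice)) : rint R_role d e -> in_tree d ->
  in_tree e.
Proof.
case: d e => [a|[a [|t p]]] [b|[b p']] //= [_ _ + [_ [t' ep]]]; rewrite {}ep.
by move=> /live_tedge[_ e] nt; case: e nt => //= ? ? [].
Qed.

(** Variables matched in a grid tree move to the kinds given by [kind_path], at the same depth below
    the same individual; the others keep their individual or their kinds. *)
Lemma transfer_inside choice cs (f : var -> dom (grid choice)) : matches cs f ->
  (forall x, label bd (VI M) x -> exists p, f x = inr p) ->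
  (forall (w : seq (option (letter M))) y, forced bd w y -> ~ label bd (VE M) y) ->
  exists h : var -> dom I, matches cs h.
Proof.
move=> [fs fc] anon noE; have g2 : gate2 = gate1 \/ gate2 = gate2 by right.
pose h x : dom I := if f x is inr (a, (t :: _) as p) then
  if not_kind t then embed a (kind_path M bd (size p) x) else embed_elt (f x) else embed_elt (f x).
have h_out x : ~~ in_tree (f x) -> h x = embed_elt (f x).
  by rewrite /h; case: (f x) => [//|[a [//|t p]]] /= /negPf ->.
have h_in x a p : f x = inr (a, p) -> in_tree (f x) -> h x = embed a (kind_path M bd (size p) x).
  by rewrite /h => -> /=; case: p => // t p ->.
have kl x a p : f x = inr (a, p) -> kind_live (kind_path M bd (size p) x).
  exact: (kind_path_live fs anon).
exists h; split; last by move=> c /fc fc1; rewrite h_out fc1.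
move=> t tb; have := fs _ tb; have := bd_sig tb; case: t tb => [B x|R x y] tb /=.
  have [tx|ntx] := boolP (in_tree (f x)); last first.
    rewrite h_out // => -[->|[v ->]]; first exact: (embed_elt_A (choice := choice) g2).
    exact: (embed_elt_vis (choice := choice) g2).
  have [a [p fx]] : exists a p, f x = inr (a, p).
    by case: (f x) tx => // -[a p]; exists a, p.
  case=> [eB|[v eB]] cB; rewrite {}eB fx in tb cB *; first by case: (forest_no_A g2 cB).
  have {}cB : @cint (grid choice) (vis_name v) (inr (a, p)) := cB.
  have [lv [t [p' [ep _]]]] := forest_vis g2 cB; rewrite {}ep in fx lv.
  rewrite (h_in _ _ _ fx) //.
  have [k [q [ek sk]]] := kind_path_shows (size p') noE tb.
  have := kl _ _ _ fx; rewrite [size _]/= ek => kl1.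
  have [_ nm] := embed_edge (live_A lv) kl1.
  by have [_ h2 _] := horn_tboxP; apply: h2 nm.
move=> eR; rewrite {}eR in tb *; move=> xy.
have [ty|nty] := boolP (in_tree (f y)); last first.
  have ntx : ~~ in_tree (f x) by apply: contra nty; apply: edge_from_tree xy.
  by rewrite !h_out //; apply: (embed_elt_edge (choice := choice)) xy.
have [k ek] := kind_path_edge M (size (if f x is inr (_, p) then p else [::])) tb.
case: (edge_into_tree xy ty) => [[a [p [t [fx fy tx lv]]]]|[a [t [fx fy er lv]]]].
  rewrite fx in ek; have := kl _ _ _ fy; rewrite [size _]/= ek => kl1.
  rewrite (h_in _ _ _ fx) // (h_in _ _ _ fy) // [size (t :: p)]/= ek.
  have [+ _] := embed_edge (live_A lv) kl1.
  have : kind_path M bd (size p) x <> [::].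
    rewrite fx in tx; case: (p) tx => //= t1 p1 _.
    by case: asboolP => // _; case: pselect.
  by case: (kind_path M bd (size p) x).
rewrite fx in ek; have := kl _ _ _ fy; rewrite [size _]/= ek => kl1.
have [+ _] := embed_edge (live_A lv) kl1.
rewrite h_out ?fx // (h_in _ _ _ fy) // [size _]/= ek /= er.
by [].
Qed.

(** The flags of kinds propagate along exactly the paths that [fits] describes, so one of them is
    set at the end, which therefore is not an E-element. *)
Lemma fits_kind with_start choice w a k p :
  fits us w (Plain (Kind M k) :: p) -> alternating w ->
  live us ab with_start choice a (Plain (Kind M k) :: p) ->
  if odd (size w) then kind_odd k else kind_even k.
Proof.
elim: w k p => [|o w IH] k p.
  by move=> [s /has_nameP ts]; inversion ts; subst.
case: p => [|t p] // [ot ft]; rewrite [alternating _]/= => /andP[/eqP ow alt] lv.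
have [lvt e] := live_tedge lv.
have [k' et kk'] : exists2 k', t = Plain (Kind M k') & kind_child k' k.
  move eqk : (Plain (Kind M k)) e => c e; case: e eqk => // k' k2 kk' [->].
  by exists k'.
rewrite {}et in ot ft lvt; have := IH _ _ ft alt lvt.
move: kk' => /andP[/eqP ko /implyP ke]; rewrite [size _]/= /= ko.
case: o ot ow => [l|] ot <- //= ko'; apply: ke; rewrite ko' /=.
by case: ot => s /has_nameP ts; inversion ts; subst.
Qed.

Lemma fragment_transfer cs :
  ~ (exists k k' ts ss, stream us k k' ts (ss : seq (letter M))) ->
  (forall choice (f : var -> dom (grid choice)), matches cs f ->
    (forall t x, List.In t bd -> x \in atom_vars t -> ~~ in_tree (f x)) \/
    (forall x, label bd (VI M) x -> exists p, f x = inr p)) ->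
  (forall J, kb_model (@alc_tbox M r us, ab) J -> exists h : var -> dom J, matches cs h) ->
  exists h : var -> dom I, matches cs h.
Proof.
move=> no_stream dich ent; have g2 : gate2 = gate1 \/ gate2 = gate2 by right.
have [[w [z fw Ez]]|noE] := pselect (exists w : seq (option (letter M)),
    exists2 z, forced bd w z & label bd (VE M) z);
  last first.
  have [f fm] := ent _ (@forest_alc_model M r ab us (fun _ _ => true) no_gate1 no_gate2).
  case: (dich _ _ fm) => [|anon]; first exact: transfer_outside.
  by apply: transfer_inside fm anon _ => w y fw Ey; apply: noE; exists w, y.
(* The adversarial model: [Finish] is chosen unless the word forced at the E-variable would then
   fit, so that this variable can be matched only at a late end. *)
pose choice (a : iname) p := ~~ `[< fits us w (ChoiceAt M true :: p) >].
have [f fm] := ent _ (@forest_alc_model M r ab us choice no_gate1 no_gate2).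
case: (dich _ _ fm) => [|anon]; first exact: transfer_outside.
have [fs _] := fm; have alt := forced_alternating fw.
have [a [p [fz lv ft]]] := forced_sound g2 fs anon fw.
have : @cint (grid choice) (vis_name (VE M)) (f z) := fs _ Ez.
rewrite fz => /(forest_vis g2) [_ [t [p' [ep [s /has_nameP ts sE]]]]].
rewrite {}ep in lv ft {fz}; case: ts sE lv ft => [{}s|x l|||b||] //=.
- case: s => // [k _ /andP[ke ko] lv ft|z0 t0 b _ /orP[/eqP|/andP[_ /eqP]] //| _ _|_ _ lv ft].
  + by have := fits_kind ft alt lv; rewrite (negPf ke) (negPf ko) if_same.
  + case: p' => [[_ [[k _ //]|[_ //]]]|t' p' /live_tedge[_ e]].
    by move eqf : (Plain (Finish M)) e => c e; case: e eqf.
  + by case: no_stream; apply: late_finish_stream lv ft => //.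
- move=> _; case: p' => [[_ [[k _ //]|[_ //]]]|t' p' [_ _ ok] ft].
  by move: ok; rewrite /= /choice asboolT.
Qed.

End Transfer.

(** * From fragments to queries *)

Lemma In_filter (T : Type) (P : pred T) (x : T) (s : seq T) :
  List.In x (filter P s) <-> P x /\ List.In x s.
Proof.
elim: s => [|y s IH] /=; first by split=> // -[].
case: ifP => Py /=; rewrite IH; split=> [|[Px [yx|]]]; try tauto.
- by case=> [<-|]; tauto.
- by rewrite yx Px in Py.
Qed.

Section Components.
Variables (q : cq) (a : seq iname).

Definition connected (x y : var) : Prop := clos_refl_sym_trans var (cq_edge q) x y.

Definition component_body (x0 : var) : seq atom :=
  [seq t <- body q | `[< exists2 y, y \in atom_vars t & connected x0 y >]].

Definition component_answer (x0 : var) : seq (var * iname) :=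
  [seq c <- zip (answer q) a | `[< connected x0 c.1 >]].

Lemma component_vars x0 t y : List.In t (component_body x0) -> y \in atom_vars t ->
  connected x0 y.
Proof.
move=> /In_filter[/asboolP[z zt xz] tb] yt; apply: rst_trans xz _.
case: t tb zt yt => [B u|R u v] /= tb; rewrite !inE.
  by move=> /eqP -> /eqP ->; apply: rst_refl.
have uv : connected u v by apply: rst_step; exists R.
by move=> /orP[] /eqP -> /orP[] /eqP ->; [exact: rst_refl | | exact: rst_sym | exact: rst_refl].
Qed.

(** Variables in different components share no atom, so matches of the components glue together;
    answer variables are pinned individually. *)
Lemma component_sat (I : interp) : size (answer q) = size a ->
  (forall x0, exists h : var -> dom I,
    matches (component_body x0) (component_answer x0) h) ->
  cq_sat I q a.
Proof.
move=> sz /choice[h hP].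
pose pick (P : var -> Prop) := if pselect (exists x, P x) is left e then projT1 (cid e) else 0.
(* By extensionality, connected variables define the same predicate and hence get the same
   representative. *)
pose rep x := pick (connected x).
have rep_conn x : connected x (rep x).
  rewrite /rep /pick; case: pselect => [e|[]]; first by case: (cid e).
  by exists x; apply: rst_refl.
have rep_eq x y : connected x y -> rep x = rep y.
  move=> xy; congr pick; apply: funext => z; apply: propext; split=> c.
    exact: rst_trans (rst_sym _ _ _ _ xy) c.
  exact: rst_trans xy c.
exists (fun x => h (rep x) x); split.
  have ans c : List.In c (zip (answer q) a) -> h (rep c.1) c.1 = inl c.2.
    move=> cin; apply: (hP (rep c.1)).2; apply/In_filter; split=> //.
    by apply/asboolP/rst_sym/rep_conn.
  elim: (answer q) a sz ans => [|x xs IH] [|b bs] //= [sz] ans.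
  have e1 : h (rep x) x = inl b := ans (x, b) (or_introl erefl).
  by rewrite e1 (IH bs) // => c cin; apply: ans; right.
move=> t tb.
have comp x : x \in atom_vars t -> List.In t (component_body (rep x)).
  move=> xt; apply/In_filter; split=> //; apply/asboolP; exists x => //.
  exact/rst_sym/rep_conn.
case: t tb comp => [B x|R x y] tb comp /=.
  by have := (hP (rep x)).1 _ (comp x (mem_head _ _)).
have -> : rep y = rep x.
  by apply/esym/rep_eq/rst_step; exists R.
by have := (hP (rep x)).1 _ (comp x (mem_head _ _)).
Qed.

End Components.

(** * Entailments between the two TBoxes *)

Section Reduction.
Variables (M : TM token) (r : rname) (us : seq datum).

Notation hornT := (@horn_tbox M r).
Notation alcT := (@alc_tbox M r us).
Notation Sigma := (sig_of (query_sig M)).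

Lemma vis_sig v : Sigma (inl (vis_name (v : vis M))).
Proof.
rewrite /sig_of /query_sig !inE; apply/orP; right; apply/orP; right.
by apply/mapP; exists v; rewrite ?mem_enum.
Qed.

Lemma Sigma_name B : Sigma (inl B) -> B = A_name \/ exists v, B = vis_name (v : vis M).
Proof.
rewrite /sig_of /query_sig !inE => /orP[/eqP[->]|/orP[/eqP //|/mapP[v _ [->]]]]; first by left.
by right; exists v.
Qed.

Lemma Sigma_role R : Sigma (inr R) -> R = R_role.
Proof. by rewrite /sig_of /query_sig !inE => /orP[/eqP //|/orP[/eqP[->]|/mapP[v _]]]. Qed.

Lemma consistent_no_gate2 ab : consistent (hornT, ab) ->
  forall a, ~ List.In (CAssert gate2 a) ab.
Proof.
move=> [I [/tbox_sat_cons[ban _] sat]] a ga.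
by apply: (ban (inl a)) => //; apply: sat ga.
Qed.

Lemma consistent_no_gate1 ab : consistent (alcT, ab) ->
  forall a, ~ List.In (CAssert gate1 a) ab.
Proof.
move=> [I [/tbox_sat_cons[_ /tbox_sat_cons[ban _]] sat]] a ga.
by apply: (ban (inl a)) => //; apply: sat ga.
Qed.

(* If the tree hangs from a role that queries cannot see, a connected query is
   matched either inside the trees or outside of them; otherwise ABoxes without
   I-assertions are enough to keep I-variables anonymous. *)
Lemma horn_entails_alc (S : signature) :
  r <> R_role \/ (forall B, S (inl B) -> B = A_name) ->
  ~ (exists k k' ts ss, stream us k k' ts (ss : seq (letter M))) ->
  tbox_query_entails CQ S Sigma hornT alcT.
Proof.
move=> sep no_stream ab ab_sig c1 c2 q _ q_sig a a_ind ent; split=> // I I_model.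
have n1 := consistent_no_gate1 c2; have n2 := consistent_no_gate2 c1.
have sz : size (answer q) = size a.
  have [J J_model] := c2; have [h [e _]] := ent J J_model.
  by have := congr1 size e; rewrite !size_map.
apply: component_sat => // x0.
apply: (@fragment_transfer M us r ab I I_model) => //.
- move=> t /In_filter[_ /q_sig]; case: t => [B x /Sigma_name|R x y /Sigma_role] //.
- move=> choice f [fs _]; case: sep => [rR|sep]; last first.
    right=> x Ix; have : cint (vis_name (VI M)) (f x) := fs _ Ix.
    by case: (f x) => [b Ib|p _]; [have := sep _ (ab_sig _ Ib) | exists p].
  have into x y : connected q x0 x -> cq_edge q x y -> in_tree (f x) = in_tree (f y).
    move=> xx0 [R xyb]; have eR := Sigma_role (q_sig _ xyb); rewrite {}eR in xyb.
    have /fs /= xy : List.In (RAtom R_role x y) (component_body q x0).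
      by apply/In_filter; split=> //; apply/asboolP; exists x; rewrite // mem_head.
    apply/idP/idP => [|ty]; first exact: edge_from_tree xy.
    by case: (edge_into_tree xy ty) => [[? [? [? [_ _ ->]]]]|[? [? [_ _ /rR]]]].
  have same_tree y : connected q x0 y -> in_tree (f x0) = in_tree (f y).
    suff st u v : connected q u v -> connected q x0 u -> in_tree (f u) = in_tree (f v).
      by move=> c; apply: st c _; apply: rst_refl.
    elim=> {u v} [u v uv x0u|//|u v uv IH x0v|u v w uv IH1 vw IH2 x0u].
    - exact: into.
    - by rewrite IH //; apply: rst_trans x0v (rst_sym _ _ _ _ uv).
    - by rewrite IH1 // IH2 //; apply: rst_trans x0u uv.
  case tx0 : (in_tree (f x0)); [right|left].
    move=> x Ix; have := same_tree x (component_vars Ix (mem_head _ _)).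
    by rewrite tx0; case: (f x) => // p _; exists p.
  by move=> t x tb xt; rewrite -same_tree ?tx0 //; apply: component_vars tb xt.
- move=> J J_model; have [h [ans hs]] := ent J J_model; exists h; split.
    by move=> t /In_filter[_ /hs].
  move=> c /In_filter[_]; elim: (answer q) (a) ans => [|x xs IH] [|b bs] //= [e1 e2].
  by case=> [<-|/IH ->].
Qed.

(** Letting [gate1] denote what [gate2] denoted, and emptying [gate2], turns a model of the ALC TBox
    into one of the Horn TBox. Queries see neither gate. *)
Lemma alc_entails_horn Q (S : signature) : tbox_query_entails Q S Sigma alcT hornT.
Proof.
move=> ab ab_sig c2 c1 q _ q_sig a a_ind ent; split=> // J [J_tbox J_abox].
have n1 := consistent_no_gate1 c2; have n2 := consistent_no_gate2 c1.
pose cint' (B : cname) (d : dom J) : Prop :=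
  if B == gate1 then cint gate2 d else if B == gate2 then False else cint B d.
pose J' := @Interp (anon J) cint' (@rint J).
have keep B (d : dom J) : B \notin [:: gate1; gate2] -> @cint J' B d = cint B d.
  by rewrite !inE negb_or => /andP[/negPf h1 /negPf h2]; rewrite /= /cint' h1 h2.
have keep_node s (d : dom J) : @cint J' (node_name (s : node M)) d = cint (node_name s) d.
  by rewrite keep //; have := node_name_range s; rewrite !inE negb_or => /andP[].
have keep_vis v (d : dom J) : @cint J' (vis_name (v : vis M)) d = cint (vis_name v) d.
  by rewrite keep //; have := vis_name_range v; rewrite !inE negb_or => /andP[].
have J'_model : kb_model (hornT, ab) J'.
  split; last first.
    move=> [B b|R b b'] sb; last exact: J_abox sb.
    change (@cint J' B (inl b)); rewrite keep; first exact: J_abox sb.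
    by rewrite !inE; apply/negP => /orP[] /eqP eB; rewrite eB in sb; [apply: n1 sb | apply: n2 sb].
  have /tbox_sat_cons[_ /tbox_sat_cons[_ /tbox_sat_cons[_ /tbox_sat_cons[_
    /tbox_sat_cat[/root_axioms_sat rt /graph_axioms_sat[gr1 gr2]]]]]] := J_tbox.
  apply/tbox_sat_cons; split=> //; apply/tbox_sat_cat; split.
    apply/root_axioms_sat => k b ko Ab; have [e be [ge ne]] := rt k b ko Ab.
    by exists e => //; split=> //; rewrite keep_node.
  apply/graph_axioms_sat; split=> [s v d _ sv [gd]|s s' d _ ss' [gd]].
    by rewrite keep_node keep_vis => nd; apply: gr1 sv _.
  rewrite keep_node => nd; have [e de [ge ne]] := gr2 s s' d isT ss' (conj gd nd).
  by exists e => //; split=> //; rewrite keep_node.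
have [h [ans hs]] := ent J' J'_model; exists h; split=> // t tb.
have := hs t tb; have := q_sig t tb; case: t tb => [B x|R x y] tb //.
move=> /Sigma_name[->|[v ->]] /=; first by rewrite /cint'.
by rewrite -[cint' _ _]/(@cint J' _ _) keep_vis.
Qed.

End Reduction.

(** * Path queries *)

Section PathQueries.
Variable M : TM token.

Notation vis := (vis M).
Notation letter := (letter M).

Fixpoint path_body (i : nat) (w : seq (option vis)) : seq atom :=
  if w is o :: w' then
    (if o is Some v then [:: CAtom (vis_name v) i] else [::]) ++
    (if w' is [::] then [::] else [:: RAtom R_role i i.+1]) ++ path_body i.+1 w'
  else [::].

Definition shown (I : interp) (o : option vis) (d : dom I) : Prop :=
  if o is Some v then cint (vis_name v) d else True.

Fixpoint path_sat (I : interp) (w : seq (option vis)) (d : dom I) : Prop :=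
  match w with
  | [::] => True
  | [:: o] => shown o d
  | o :: w' => shown o d /\ exists2 e, rint R_role d e & path_sat w' e
  end.

Fixpoint reach (I : interp) (w : seq (option vis)) (d d' : dom I) : Prop :=
  if w is o :: w' then shown o d /\ exists2 e, rint R_role d e & reach w' e d'
  else d = d'.

Lemma path_body_vars i w t x : List.In t (path_body i w) -> x \in atom_vars t ->
  i <= x < i + size w.
Proof.
elim: w i => [|o w IH] i //= /In_cat[|/In_cat[|/IH h /h]].
- by case: o => //= v [<-|//]; rewrite inE => /eqP ->; lia.
- by case: w {IH} => //= o' w [<-|//]; rewrite !inE => /orP[] /eqP ->; lia.
- by lia.
Qed.

Lemma path_sat_match I w (d : dom I) i : path_sat w d ->
  exists2 h : var -> dom I, h i = d & forall t, List.In t (path_body i w) -> atom_sat h t.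
Proof.
elim: w d i => [|o w IH] d i ps; first by exists (fun _ => d).
have [so [e' de' [h hi hs]]] : shown o d /\ exists2 e, (w <> [::] -> rint R_role d e) &
    exists2 h : var -> dom I, h i.+1 = e & forall t, List.In t (path_body i.+1 w) -> atom_sat h t.
  case: w ps IH => [so _|o' w [so [e de ps]] IH]; last by split=> //; exists e => //; apply: IH.
  by split=> //; exists d => //; exists (fun _ => d).
exists (fun x => if x == i then d else h x); rewrite ?eqxx // => t.
have out x : List.In t (path_body i.+1 w) -> x \in atom_vars t -> (x == i) = false.
  by move=> tb xt; have := path_body_vars tb xt; lia.
move=> /= /In_cat[|/In_cat[|tb]].
- by case: o so {ps} => //= v sv [<-|//] /=; rewrite eqxx.
- case: w de' hi {IH ps hs out} => //= o' w de' hi [<-|//] /=.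
  by rewrite eqxx eqn_leq ltnn hi; apply: de'.
- have := hs _ tb; case: t tb out {hs} => [B x|R x y] tb out /=.
    by rewrite out ?mem_head.
  by rewrite !out ?inE ?eqxx ?orbT.
Qed.

Lemma reach_cat I w1 w2 (d e f : dom I) : reach w1 d e -> reach w2 e f -> reach (w1 ++ w2) d f.
Proof.
elim: w1 d => [|o w IH] d /=; first by move=> ->.
by move=> [so [d' dd' rd]] re; split=> //; exists d' => //; apply: IH.
Qed.

Lemma path_sat_cons I o w (d : dom I) : w != [::] ->
  path_sat (o :: w) d = (shown o d /\ exists2 e, rint R_role d e & path_sat w e).
Proof. by case: w. Qed.

Lemma reach_path I w1 w2 (d e : dom I) : w2 != [::] -> reach w1 d e -> path_sat w2 e ->
  path_sat (w1 ++ w2) d.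
Proof.
move=> w2n; elim: w1 d => [|o w IH] d; first by move=> ->.
move=> [so [d' dd' rd]] pe; rewrite cat_cons path_sat_cons; last first.
  by rewrite -size_eq0 size_cat addn_eq0 negb_and size_eq0 size_eq0 w2n orbT.
by split=> //; exists d' => //; apply: IH.
Qed.

Lemma path_sat_head I o w (d : dom I) : path_sat (None :: w) d -> shown o d ->
  path_sat (o :: w) d.
Proof. by case: w => [|o' w] //= [_ h] so. Qed.

Lemma reach_head I o w (d e : dom I) : reach (None :: w) d e -> shown o d ->
  reach (o :: w) d e.
Proof. by move=> [_ h] so. Qed.

Fixpoint weaker (w' w : seq (option vis)) : Prop :=
  match w', w with
  | [::], [::] => True
  | o' :: w', o :: w => (o' = None \/ o' = o) /\ weaker w' w
  | _, _ => False
  end.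

Lemma reach_weaker I w' w (d e : dom I) : weaker w' w -> reach w d e -> reach w' d e.
Proof.
elim: w' w d => [|o' w' IH] [|o w] d //= [oo ww] [so [d' dd' rd]].
by split; [case: oo => -> | exists d' => //; apply: IH rd].
Qed.

Definition weave (xs : seq letter) : seq (option vis) :=
  flatten [seq [:: Some (VL x); None] | x <- xs].

Definition gap_weave (xs : seq letter) : seq (option vis) :=
  flatten [seq [:: None; Some (VL x)] | x <- xs].

(** What a grid branch spells after the initial row. Forgetting the old letters leaves [weave],
    forgetting the new ones [gap_weave]: the two readings of the same branch. *)
Fixpoint mixed (ts ss : seq letter) : seq (option vis) :=
  match ts, ss with
  | t :: ts, s :: ss => [:: Some (VL t), Some (VL s) & mixed ts ss]
  | _, _ => [::]
  end.

Definition run_word (xs : seq letter) : seq (option vis) :=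
  Some (VI M) :: weave xs ++ [:: Some (VE M)].

Lemma gap_weave_rcons xs w : gap_weave xs ++ None :: w = None :: weave xs ++ w.
Proof. by elim: xs => //= x xs ->. Qed.

Lemma weave_cat xs ys : weave (xs ++ ys) = weave xs ++ weave ys.
Proof. by rewrite /weave map_cat flatten_cat. Qed.

Lemma gap_weave_cat xs ys : gap_weave (xs ++ ys) = gap_weave xs ++ gap_weave ys.
Proof. by rewrite /gap_weave map_cat flatten_cat. Qed.

Lemma size_weave xs : size (weave xs) = (size xs).*2.
Proof. by elim: xs => //= x xs ->. Qed.

Lemma weaker_new ts ss : size ts = size ss -> weaker (weave ts) (mixed ts ss).
Proof.
elim: ts ss => [|t ts IH] [|s ss] //= [sz].
by split; [right | split; [left | apply: IH]].
Qed.

Lemma weaker_old ts ss : size ts = size ss -> weaker (gap_weave ss) (mixed ts ss).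
Proof.
elim: ts ss => [|t ts IH] [|s ss] //= [sz].
by split; [left | split; [right | apply: IH]].
Qed.

(** ** Runs in models of the ALC TBox *)

Section Runs.
Variables (r : rname) (us : seq datum) (ab : abox) (J : interp).
Hypothesis J_model : kb_model (@alc_tbox M r us, ab) J.

Let at_node (s : node M) (d : dom J) : Prop := named gate2 s d.

Lemma alc_tboxP :
  [/\ forall d, at_node (Literal M) d -> ceval (chain (gated gate2 (AfterLiteral M)) us) d,
    forall d, at_node (Choice M) d -> at_node (Finish M) d \/ at_node (Gap M) d,
    forall a : dom J, cint A_name a -> exists2 d, rint r a d & at_node (Start M) d,
    forall s v d, shows s v -> at_node s d -> cint (vis_name (v : vis)) d &
    forall s s' d, child s s' -> at_node s d -> exists2 e, rint R_role d e & at_node s' e].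
Proof.
have [/tbox_sat_cons[lit /tbox_sat_cons[_ /tbox_sat_cons[cho /tbox_sat_cons[st
  /tbox_sat_cat[_ /graph_axioms_sat[gr1 gr2]]]]]] _] := J_model.
split=> //.
- move=> d nd; have h := cho d nd; apply: contrapT => nn; apply: h => /=.
  by split=> n; apply: nn; [left | right]; split=> //; case: nd.
- by move=> a /st[e [ae ne]]; exists e.
- by move=> s v d; apply: gr1.
- by move=> s s' d; apply: gr2.
Qed.

Lemma reach_pair s s' s'' x d : at_node s d -> child s s' -> shows s' (VL x) ->
  child s' s'' -> exists2 e, reach [:: None; Some (VL x)] d e & at_node s'' e.
Proof.
have [_ _ _ sh ch] := alc_tboxP; move=> sd cs sx cs'.
have [e de ne] := ch _ _ _ cs sd; have [e' ee' ne'] := ch _ _ _ cs' ne.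
exists e' => //; split=> //; exists e => //; split; first exact: sh ne.
by exists e'.
Qed.

Lemma reach_repeat s s' x n d : at_node s d -> child s s' -> shows s' (VL x) ->
  child s' s -> exists2 e, reach (gap_weave (nseq n x)) d e & at_node s e.
Proof.
move=> sd cs sx cs'; elim: n d sd => [|n IH] d sd; first by exists d.
have [e de ne] := reach_pair sd cs sx cs'; have [f ef nf] := IH e ne.
by exists f => //; apply: (reach_cat (w1 := [:: _; _]) de ef).
Qed.

Lemma reach_any xs d : at_node (Gap M) d ->
  exists2 e, reach (gap_weave xs) d e & at_node (Gap M) e.
Proof.
elim: xs d => [|x xs IH] d gd; first by exists d.
have [e de ne] := @reach_pair _ (AnyLetter M) (Gap M) x _ gd isT isT isT.
by have [f ef nf] := IH e ne; exists f => //; apply: (reach_cat (w1 := [:: _; _]) de ef).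
Qed.

Lemma reach_chain C us' (d : dom J) : ceval (chain C us') d ->
  exists2 e, reach (gap_weave (map (datum_letter M) us')) d e & ceval C e.
Proof.
elim: us' d => [|x us' IH] d; first by exists d.
move=> [e [de [ge [xe [f [ef fc]]]]]].
have [f' ff' Cf'] := IH f fc; exists f' => //.
have [_ _ _ sh _] := alc_tboxP.
split=> //; exists e => //; split; last by exists f.
by apply: (sh (Datum M x)); [apply/eqP | split].
Qed.

Lemma reach_initial k k' d : at_node (Start M) d ->
  exists2 e, reach (gap_weave (initial_row M us k k')) d e & at_node (RowGap M) e.
Proof.
move=> sd; have [lit _ _ _ _] := alc_tboxP.
have [d1 dd1 [s [sd1 cs]]] : exists2 d1, reach (gap_weave (nseq k (left_pad M false))) d d1 &
    exists s, at_node s d1 /\ child s (LeftPad M true).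
  case: k => [|k]; first by exists d => //; exists (Start M).
  have [e de ne] := @reach_pair _ (LeftPad M false) (LeftGap M) (left_pad M false) _ sd isT (eqxx _) isT.
  have [f ef nf] := @reach_repeat _ (LeftPad M false) (left_pad M false) k _ ne isT (eqxx _) isT.
  by exists f; [apply: (reach_cat (w1 := [:: _; _]) de ef) | exists (LeftGap M)].
have [d2 dd2 nd2] := @reach_pair _ (LeftPad M true) (Literal M) (left_pad M true) _ sd1 cs (eqxx _) isT.
have [d3 dd3 nd3] := reach_chain (lit _ nd2).
have [d4 dd4 nd4] := @reach_repeat _ (RightPad M false) (right_pad M false) k' _
  (nd3 : at_node (AfterLiteral M) d3) isT (eqxx _) isT.
have [d5 dd5 nd5] := @reach_pair _ (RightPad M true) (RowGap M) (right_pad M true) _ nd4 isT (eqxx _) isT.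
exists d5 => //; rewrite /initial_row -cats1 -(cat1s (left_pad M true)) !gap_weave_cat.
exact: (reach_cat dd1 (reach_cat dd2 (reach_cat dd3 (reach_cat dd4 dd5)))).
Qed.

Lemma reach_run z t ts s ss b d : size ts = size ss ->
  run z (zip (s :: ss) (t :: ts)) -> at_node (NewLetter z t b) d ->
  exists2 e, reach (mixed (t :: ts) (s :: ss)) d e & at_node (Choice M) e.
Proof.
have [_ _ _ sh ch] := alc_tboxP.
have new_old (z1 : astate M) t1 s1 b1 : child (NewLetter z1 t1 b1) (OldLetter z1 t1 s1).
  by rewrite /= !eqxx.
elim: ts ss z t s b d => [|t' ts IH] [|s' ss] z t s b d // sz rn nd.
  have [e de ne] := ch _ _ _ (new_old z t s b) nd.
  have [f ef nf] := ch _ _ _ (rn : child (OldLetter z t s) (Choice M)) ne; exists f => //.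
  split; first by apply: sh nd; rewrite /= eqxx.
  exists e => //; split; first by apply: sh ne; rewrite /= eqxx.
  by exists f.
have [z' nx rn'] : exists2 z', anext z s t z' & run z' (zip (s' :: ss) (t' :: ts)) by [].
have [e de ne] := ch _ _ _ (new_old z t s b) nd.
have [f ef nf] := ch _ _ _ (nx : child (OldLetter z t s) (NewLetter z' t' false)) ne.
case: sz => sz; have [g fg ng] := IH _ _ _ _ _ _ sz rn' nf; exists g => //.
split; first by apply: sh nd; rewrite /= eqxx.
exists e => //; split; first by apply: sh ne; rewrite /= eqxx.
by exists f.
Qed.

Lemma stream_path k k' ts ss a : stream us k k' ts ss -> @cint J A_name a ->
  exists2 d, rint r a d &
    path_sat (run_word (initial_row M us k k' ++ ts)) d \/
    (exists2 e, reach (nseq (size (initial_row M us k k')).*2.+1 None) d e &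
      path_sat (run_word (initial_row M us k k' ++ ts)) e).
Proof.
move=> [e [z [zi rn sz eq_s]]] Aa; have [_ cho st sh ch] := alc_tboxP.
have [d ad sd] := st _ Aa; exists d => //.
have [d0 dd0 nd0] := reach_initial k k' sd.
case: ts sz rn eq_s => [|t ts]; first by case: ss.
case: ss => [|s ss] // [sz] rn eq_s.
have [d1 dd1 nd1] := ch _ _ _ (zi : child (RowGap M) (NewLetter z t true)) nd0.
have rd1 : reach (None :: weave (initial_row M us k k')) d d1.
  rewrite -[weave _]cats0 -gap_weave_rcons; apply: reach_cat dd0 _.
  by split=> //; exists d1.
have [c dc nc] := reach_run sz rn nd1.
have sz1 : size (t :: ts) = size (s :: ss) by rewrite /= sz.
case: (cho _ nc) => [nf|ng]; [left|right].
  rewrite /run_word weave_cat -catA -cat_cons.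
  apply: reach_path (reach_head rd1 _) _; first by case: (weave _).
    by apply: sh sd.
  apply: reach_path (reach_weaker (weaker_new sz1) dc) _ => //.
  by apply: sh nf.
exists d1.
  have : weaker (nseq (size (initial_row M us k k')).*2.+1 None)
      (None :: weave (initial_row M us k k')).
    rewrite -size_weave; split; first by left.
    by elim: (weave _) => //= o w IH; split; [left|].
  by move/reach_weaker; apply.
have [c2 cc2 nc2] := reach_any e ng.
have [f c2f nf] := ch _ (LateFinish M) _ (isT : child (Gap M) (LateFinish M)) nc2.
apply: path_sat_head; last by apply: (sh _ (VI M) _ _ nd1); rewrite /= eqxx.
(* The stream equation turns the word into [ss] followed by [e]: the old letters, and then letters
   freely available below [Gap]. *)
rewrite eq_s -gap_weave_rcons gap_weave_cat -catA.
apply: reach_path (reach_weaker (weaker_old sz1) dc) _; first by case: (gap_weave e).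
apply: reach_path cc2 _ => //.
by split=> //; exists f => //; apply: sh nf.
Qed.

End Runs.

End PathQueries.

(** * Queries that separate the TBoxes in the presence of a stream *)

Section Separation.
Variables (M : TM token) (r : rname) (us : seq datum).

Notation vis := (vis M).
Notation letter := (letter M).
Notation hornT := (@horn_tbox M r).
Notation alcT := (@alc_tbox M r us).
Notation Sigma := (sig_of (query_sig M)).

Lemma path_vars (is_rooted : bool) n :
  nseq is_rooted 0 ++ iota is_rooted (n.+1 - is_rooted) = iota 0 n.+1.
Proof. by case: is_rooted; rewrite ?subn1 ?subn0. Qed.

Lemma path_cq_uniq (is_rooted : bool) n :
  uniq (nseq is_rooted 0 ++ iota is_rooted (n.+1 - is_rooted)).
Proof. by rewrite path_vars iota_uniq. Qed.

Lemma path_cq_closed (is_rooted : bool) (o : option vis) w t :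
  List.In t (path_body 0 (o :: w)) ->
  {subset atom_vars t <= nseq is_rooted 0 ++ iota is_rooted ((size w).+1 - is_rooted)}.
Proof.
move=> tb x xt; rewrite path_vars mem_iota.
by have := path_body_vars tb xt.
Qed.

(** The boolean serves as a number of answer variables: the query is Boolean, or its first variable
    is the answer variable. *)
Definition path_cq (is_rooted : bool) (o : option vis) (w : seq (option vis)) : cq :=
  MkCQ (path_cq_uniq is_rooted (size w)) (@path_cq_closed is_rooted o w).

Lemma path_body_edge i j (o : option vis) w : j < size w ->
  List.In (RAtom R_role (i + j) (i + j).+1) (path_body i (o :: w)).
Proof.
elim: w i j o => [|o' w IH] i [|j] o // lt_j; apply/In_cat; right.
  by rewrite addn0; left.
by right; rewrite addnS -addSn; apply: IH.
Qed.

Lemma path_cq_rooted o w : rooted (path_cq true o w).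
Proof.
move=> y; rewrite /= subn1 mem_iota => /andP[_ lt_y]; exists 0; first by rewrite inE.
have {lt_y} : y <= size w by lia.
elim: y => [_|y IH lt_y]; first exact: rst_refl.
apply: rst_trans (IH (ltnW lt_y)) _; apply: rst_step; exists R_role.
exact: (path_body_edge 0 o lt_y).
Qed.

Lemma path_cq_sig is_rooted o w : sig_cq Sigma (path_cq is_rooted o w).
Proof.
move=> t /=; rewrite -[_ ++ _]/(path_body 0 (o :: w)).
elim: (o :: w) 0 => [|o1 w1 IH] i // /In_cat[|/In_cat[|/IH //]].
  by case: o1 => //= v [<-|//]; apply: vis_sig.
by case: (w1) => //= o2 w2 [<-|//].
Qed.

Lemma path_body_cat i w1 w2 (t : atom) :
  List.In t (path_body (i + size w1) w2) -> List.In t (path_body (M := M) i (w1 ++ w2)).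
Proof.
elim: w1 i => [|o w1 IH] i; first by rewrite addn0.
rewrite /= addnS -addSn => /IH h; apply/In_cat; right; apply/In_cat; right.
exact: h.
Qed.

Lemma path_body_tail i (o : option vis) w t :
  List.In t (path_body i.+1 w) -> List.In t (path_body i (o :: w)).
Proof. by move=> tb; apply/In_cat; right; apply/In_cat; right. Qed.

Lemma weave_forced bd xs w i :
  (forall t, List.In t (path_body i (weave xs ++ [:: Some (VE M)])) -> List.In t bd) ->
  odd (size w) -> forced (M := M) bd w i ->
  exists w' z, forced (M := M) bd w' z /\ label bd (VE M) z.
Proof.
elim: xs w i => [|x xs IH] w i sub ow fw.
  by exists w, i; split=> //; apply: sub; left.
have sub2 t : List.In t (path_body i.+1 (None :: weave xs ++ [:: Some (VE M)])) -> List.In t bd.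
  by move=> tb; apply: sub; apply: (@path_body_tail _ (Some (VL x))).
have Lx : label bd (VL x) i by apply: sub; left.
have e1 : edge bd i i.+1.
  by apply: sub; have := @path_body_edge i 0 (Some (VL x))
    (None :: weave xs ++ [:: Some (VE M)]) isT; rewrite addn0.
have e2 : edge bd i.+1 i.+2.
  apply: sub2; have := @path_body_edge i.+1 0 None (weave xs ++ [:: Some (VE M)]).
  by rewrite size_cat addn1 addn0; apply.
have fw1 := forced_odd ow fw (forced_below fw) Lx e1.
have ev : ~~ odd (size (Some x :: w)) by rewrite /= ow.
apply: (IH (None :: Some x :: w) i.+2) (forced_even ev fw1 e2); last by rewrite /= ow.
by move=> t tb; apply: sub2; apply: (@path_body_tail _ None).
Qed.

Lemma live_is_kind ab choice a t p :
  live us ab false choice a (t :: p) -> exists k, t = Plain (Kind M k).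
Proof.
elim: p t => [|t' p IH] t; first by move=> [_ [[k _ ->]|[]]] //; exists k.
move=> /live_tedge[/IH[k ->]].
move eqk : (Plain (Kind M k)) => c e; case: e eqk => // [k1 k2 _ _|_ [] //|_ [] //].
by exists k2.
Qed.

(** The path query forces a path from its I-variable to its E-variable, and kinds make every end of
    such a path miss [E_name]. *)
Lemma run_word_unmatched ab choice i xs bd
    (f : var -> dom (@forest M us r ab gate1 false choice)) :
  (forall a, ~ List.In (CAssert I_name a) ab) ->
  (forall t, List.In t (path_body i (run_word (M := M) xs)) -> List.In t bd) ->
  ~ (forall t, List.In t bd -> atom_sat f t).
Proof.
move=> noI sub fs; have g1 : gate1 = gate1 \/ gate1 = gate2 by left.
have anon x : label bd (VI M) x -> exists p, f x = inr p.
  move=> /fs /=; case: (f x) => [a /noI //|p _]; by exists p.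
have Ii : label bd (VI M) i by apply: sub; left.
have e1 : edge bd i i.+1.
  apply: sub; have := @path_body_edge i 0 (Some (VI M)) (weave xs ++ [:: Some (VE M)]).
  by rewrite size_cat addn1 addn0; apply.
have f1 : forced (M := M) bd [:: None] i.+1 by apply: forced_even (forced_I Ii) e1.
have [|w [z [fw Ez]]] := weave_forced _ (isT : odd (size [:: None : option letter])) f1 (xs := xs).
  by move=> t tb; apply: sub; apply: (@path_body_tail _ (Some (VI M))).
have [a [p [fz lv ft]]] := forced_sound g1 fs anon fw.
have : @cint (forest us r ab gate1 false choice) (vis_name (VE M)) (f z) := fs _ Ez.
rewrite fz => /(forest_vis g1)[_ [t [p' [ep [s /has_nameP ts sE]]]]].
rewrite {}ep in lv ft {fz}; have [k et] := live_is_kind lv.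
rewrite {}et in lv ft ts; have := fits_kind ft (forced_alternating fw) lv.
inversion ts; subst; move: sE => /= /andP[/negPf -> /negPf ->].
by rewrite if_same.
Qed.

Lemma reach_loop (I : interp) n (x d : dom I) : rint R_role x x -> rint R_role x d ->
  reach (nseq n.+1 (None : option vis)) x d.
Proof.
by move=> xx xd; elim: n => [|n IH]; [split=> //; exists d | split=> //; exists x].
Qed.

(* The loop at the individual lets the rooted query absorb the initial row. *)
Lemma stream_separates Q (S : signature) (is_rooted : bool) k k' ts ss :
  stream us k k' ts (ss : seq letter) ->
  S (inl A_name) -> (is_rooted -> r = R_role /\ S (inr R_role)) ->
  (Q = RCQ -> is_rooted) ->
  ~ tbox_query_entails Q S Sigma hornT alcT.
Proof.
move=> str SA rt Qr ent.
pose ab := CAssert A_name 0 :: (if is_rooted then [:: RAssert R_role 0 0] else [::]).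
have in_ab B b : List.In (CAssert B b) ab -> B = A_name.
  by rewrite /ab; case: (is_rooted) => -[[<-]|] //= [].
have n1 b : ~ List.In (CAssert gate1 b) ab by move/in_ab.
have n2 b : ~ List.In (CAssert gate2 b) ab by move/in_ab.
have nI b : ~ List.In (CAssert I_name b) ab by move/in_ab.
pose any (_ : iname) (_ : seq (tnode M)) := true.
have horn_m := @forest_horn_model M r ab us false any n1 n2.
have c1 : consistent (hornT, ab) by exists (forest us r ab gate1 false any).
have c2 : consistent (alcT, ab).
  by exists (forest us r ab gate2 true any); apply: forest_alc_model.
have ab_sig : sig_abox S ab.
  move=> t [<- //|]; case er: (is_rooted) => // -[<-|//].
  by have [|_ SR] := rt; first by rewrite er.
pose xs := initial_row M us k k' ++ ts.
(* The second reading starts one edge plus [(size (initial_row M us k k')).*2.+1] edges away from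
   the individual. For the first reading, which starts at the root of the tree, the loop supplies
   all of these edges but one. *)
pose n := if is_rooted then (size (initial_row M us k k')).*2.+2 else 0.
pose word : seq (option vis) := nseq n None ++ run_word xs.
have [o [w ew]] : exists o w, word = o :: w.
  by rewrite /word; case: (n) => [|m]; do 2 eexists.
pose q := path_cq is_rooted o w.
have alc_q : kb_entails (alcT, ab) q (nseq is_rooted 0).
  move=> J J_model; have A0 : @cint J A_name (inl 0).
    by case: J_model => _ sat; exact: (sat (CAssert A_name 0) (or_introl erefl)).
  have [d ad path] := stream_path J_model str A0.
  have [e ps er] : exists2 e : dom J, path_sat word e & (is_rooted -> e = inl 0).
    rewrite /word /n; move: ad rt path; case er: (is_rooted); last first.
      by move=> _ _ [ps|[e _ ps]]; [exists d | exists e].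
    move=> + /(_ isT)[rR _] path; rewrite rR => ad; exists (inl 0) => //.
    have loop : @rint J R_role (inl 0) (inl 0).
      have loop_ab : List.In (RAssert R_role 0 0) ab by rewrite /ab er; right; left.
      by case: J_model => _ sat; exact: (sat _ loop_ab).
    case: path => [ps|[e re ps]]; first exact: reach_path (reach_loop _ loop ad) ps.
    by apply: reach_path ps => //; split=> //; exists d.
  rewrite ew in ps; have [h h0 hs] := path_sat_match 0 ps; exists h; split=> //.
  by move: er; rewrite -h0 /=; case: (is_rooted) => //= ->.
have sub : {subset nseq is_rooted 0 <= ind (alcT, ab)}.
  by move=> x; rewrite mem_nseq => /andP[_ /eqP ->]; rewrite /ind /= inE eqxx.
have q_class : in_class Q q.
  by case: Q Qr {ent} => //= /(_ erefl) er; rewrite /q er; apply: path_cq_rooted.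
have [_ /(_ _ horn_m)[h [_ hs]]] :=
  ent ab ab_sig c1 c2 q q_class (@path_cq_sig is_rooted o w) _ sub alc_q.
apply: (run_word_unmatched (i := n) (xs := xs) nI _ hs).
move=> t tb; change (List.In t (path_body 0 (o :: w))); rewrite -ew.
by apply: path_body_cat; rewrite size_nseq add0n.
Qed.

End Separation.

(** * Undecidability *)

Section Undecidability.
Variable M : TM token.

Definition self_alc_tbox (r : rname) (tail : seq token) : tbox :=
  @alc_tbox M r (self_data M r tail).

Definition self_encoding (r : rname) (tail : seq token) : seq token :=
  enc_tbox (@horn_tbox M r) ++ enc_tbox (self_alc_tbox r tail) ++ tail.

Lemma self_accepts r tail :
  (exists k k' ts ss, stream (self_data M r tail) k k' ts (ss : seq (letter M))) <->
  accepts M (self_encoding r tail).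
Proof.
rewrite /self_encoding /self_alc_tbox enc_self; split.
  by move=> [k [k' [ts [ss]]]]; apply: stream_accepts.
by move/accepts_stream.
Qed.

Lemma class_mono Q S S2 T1 T2 :
  tbox_query_entails CQ S S2 T1 T2 -> tbox_query_entails Q S S2 T1 T2.
Proof. by move=> h ab absig c1 c2 q _; apply: h. Qed.

Lemma self_entailment Q (S : signature) r tail (is_rooted : bool) :
  S (inl A_name) -> (is_rooted -> r = R_role /\ S (inr R_role)) -> (Q = RCQ -> is_rooted) ->
  r <> R_role \/ (forall B, S (inl B) -> B = A_name) ->
  tbox_query_entails Q S (sig_of (query_sig M)) (@horn_tbox M r) (self_alc_tbox r tail) <->
  ~ accepts M (self_encoding r tail).
Proof.
move=> SA rt Qr sep; split=> [ent /self_accepts[k [k' [ts [ss str]]]]|nacc].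
  exact: stream_separates str SA rt Qr ent.
by apply/class_mono/horn_entails_alc => // /self_accepts.
Qed.

Lemma self_inseparability Q (S : signature) r tail (is_rooted : bool) :
  S (inl A_name) -> (is_rooted -> r = R_role /\ S (inr R_role)) -> (Q = RCQ -> is_rooted) ->
  r <> R_role \/ (forall B, S (inl B) -> B = A_name) ->
  tbox_inseparable Q S (sig_of (query_sig M)) (@horn_tbox M r) (self_alc_tbox r tail) <->
  ~ accepts M (self_encoding r tail).
Proof.
move=> SA rt Qr sep; rewrite -(self_entailment tail SA rt Qr sep); split=> [[]//|h].
by split=> //; apply: alc_entails_horn.
Qed.

End Undecidability.

Lemma diagonal (Inst : Type) (enc : Inst -> seq token) (valid yes : Inst -> Prop) :
  (forall M : TM token, exists2 x, valid x & yes x <-> ~ accepts M (enc x)) ->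
  undecidable enc valid yes.
Proof.
move=> self [M dec]; have [x vx yx] := self M; have [acc_x rej_x] := dec x vx.
have [y|ny] := pselect (yes x); first by move/yx: (y); apply; apply: acc_x.
have [a|na] := pselect (accepts M (enc x)); last by apply/ny/yx.
exact: accepts_rejects a (rej_x ny).
Qed.

(** [A_name] as the only concept name keeps I-variables off the individuals; the role is there for
    the loop of the separating ABox. *)
Definition abox_sig : finsig := [:: inl A_name; inr R_role].

Definition separate_instance (M : TM token) : instance :=
  Instance (@horn_tbox M R_role)
    (self_alc_tbox M R_role (enc_sig abox_sig ++ enc_sig (query_sig M)))
    abox_sig (query_sig M).

(** The common signature contains [I_name], so the trees hang from [P_role], which it lacks. *)
Definition equal_instance (M : TM token) : instance :=
  Instance (@horn_tbox M P_role)
    (self_alc_tbox M P_role (enc_sig (query_sig M) ++ enc_sig (query_sig M)))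
    (query_sig M) (query_sig M).

Definition full_sig_instance (M : TM token) : full_instance :=
  FullInstance (@horn_tbox M P_role)
    (self_alc_tbox M P_role (enc_sig (query_sig M))) (query_sig M).

Lemma abox_sig_names B : sig_of abox_sig (inl B) -> B = A_name.
Proof. by rewrite /sig_of /abox_sig !inE => /orP[/eqP[]|/eqP]. Qed.

Theorem theorem4 :
  (forall Q : qclass,
     undecidable enc_instance horn_instance (entailment Q)) /\
  (forall Q : qclass,
     undecidable enc_instance horn_instance (inseparability Q)) /\
  (undecidable enc_full_instance horn_full_instance (full_entailment CQ) /\
   undecidable enc_full_instance horn_full_instance (full_inseparability CQ)) /\
  (undecidable enc_instance
     (fun i => horn_instance i /\ equal_sigs i) (entailment CQ) /\
   undecidable enc_instance
     (fun i => horn_instance i /\ equal_sigs i) (inseparability CQ)).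
Proof.
have PR : P_role <> R_role by [].
have SA M : sig_of (query_sig M) (inl A_name) by rewrite /sig_of inE eqxx.
split; [|split; [|split; split]].
- move=> Q; apply: diagonal => M; exists (separate_instance M); first exact: horn_horn_tbox.
  by apply: (@self_entailment M Q _ _ _ true) => //; right; apply: abox_sig_names.
- move=> Q; apply: diagonal => M; exists (separate_instance M); first exact: horn_horn_tbox.
  by apply: (@self_inseparability M Q _ _ _ true) => //; right; apply: abox_sig_names.
- apply: diagonal => M; exists (full_sig_instance M); first exact: horn_horn_tbox.
  by apply: (@self_entailment M CQ _ _ _ false) => //; left.
- apply: diagonal => M; exists (full_sig_instance M); first exact: horn_horn_tbox.
  by apply: (@self_inseparability M CQ _ _ _ false) => //; left.
- apply: diagonal => M; exists (equal_instance M); first by split; first exact: horn_horn_tbox.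
  by apply: (@self_entailment M CQ _ _ _ false) => //; left.
- apply: diagonal => M; exists (equal_instance M); first by split; first exact: horn_horn_tbox.
  by apply: (@self_inseparability M CQ _ _ _ false) => //; left.
Qed.
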